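(* Let $\delta_\pi=\frac12-\frac1\pi$. For every fixed $c<\delta_\pi$ there are constants $C_c,\gamma_c>0$ (depending only on $c$) such that for every $n\ge1$, every $g\in\mathcal E_n^+\cup\mathcal E_n^-$ satisfies $$\sum_{0\le i<\lceil cn\rceil}\binom ni|g_i|\le C_ce^{-\gamma_cn}\sum_{i=0}^n\binom ni|g_i|.$$
   Context: For $n\ge1$ and $0\le i,j\le n$, define $K_j^{(n)}(i)$ by $\sum_{j=0}^n K_j^{(n)}(i)z^j=(1+z)^{n-i}(1-z)^i$. For $u=(u_0,\dots,u_n)\in\mathbb R^{n+1}$ the Krawtchouk transform is $$(\mathcal K_nu)_k=2^{-n/2}\sum_{i=0}^nK_i^{(n)}(k)u_i\qquad(0\le k\le n),$$ which is an involution of $\mathbb R^{n+1}$; $\mathcal E_n^{\pm}$ denotes its eigenspace with eigenvalue $\pm1$. *)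

(* Defs.v *)
From HB Require Import structures.
From mathcomp Require Import all_boot all_order all_algebra.
From mathcomp Require Import reals sequences exp trigo.

Set Implicit Arguments.
Unset Strict Implicit.
Unset Printing Implicit Defensive.

Import Order.TTheory GRing.Theory Num.Theory.
Local Open Scope ring_scope.

(* K_j^(n)(i), meaningful for i, j <= n: the coefficient of z^j in
   (1 + z)^(n - i) (1 - z)^i. *)
Definition krawtchouk (R : realType) (n j i : nat) : R :=
  ((1 + 'X) ^+ (n - i) * (1 - 'X) ^+ i : {poly R})`_j.

Definition krawtchouk_transform (R : realType) (n : nat) (u : 'rV[R]_n.+1) :
    'rV[R]_n.+1 :=
  \row_k (2 `^ (- (n%:R / 2)) * \sum_(i < n.+1) krawtchouk R n i k * u 0 i).

Lemma krawtchouk_transform_is_linear (R : realType) (n : nat) :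
  linear (@krawtchouk_transform R n).
Proof.
move=> a u v; apply/rowP => k; rewrite !mxE mulrCA -mulrDr; congr (_ * _).
rewrite mulr_sumr -big_split /=; apply: eq_bigr => i _.
by rewrite !mxE mulrDr mulrCA.
Qed.

HB.instance Definition _ (R : realType) (n : nat) :=
  GRing.isLinear.Build R 'rV[R]_n.+1 'rV[R]_n.+1 _ (@krawtchouk_transform R n)
    (@krawtchouk_transform_is_linear R n).

(* A square matrix whose row space is the eigenspace of the transform for the
   eigenvalue a. *)
Definition krawtchouk_eigenspace (R : realType) (n : nat) (a : R) :
    'M[R]_n.+1 :=
  eigenspace (lin1_mx (@krawtchouk_transform R n)) a.

Lemma krawtchouk_eigenspaceP (R : realType) (n : nat) (a : R)
    (u : 'rV[R]_n.+1) :
  reflect (krawtchouk_transform u = a *: u)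
    (u <= krawtchouk_eigenspace n a)%MS.
Proof.
by apply: (iffP eigenspaceP); rewrite mul_rV_lin1.
Qed.

(* Main.v *)
Require Import Defs.
From mathcomp Require Import all_boot all_order all_algebra.
From mathcomp Require Import reals sequences exp trigo.
From mathcomp Require Import boolp classical_sets functions interval_inference.
From mathcomp Require Import topology normedtype.
From mathcomp Require Import derive realfun.
From mathcomp Require Import complex.
From mathcomp Require Import ring lra zify.

Import Order.TTheory GRing.Theory Num.Theory.
Import numFieldNormedType.Exports.
Local Open Scope ring_scope.

Set Implicit Arguments.
Unset Strict Implicit.
Unset Printing Implicit Defensive.

(** Let P(z) = sum_k 'C(n, k) g_k z^k and let S be the sum of the moduli of its
    coefficients.  On generating functions the Krawtchouk transform acts by the
    substitution z |-> (1 - z) / (1 + z), so an eigenvector g satisfies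

      P(z) = +- 2^(-n/2) sum_i 'C(n, i) g_i (1 - z)^i (1 + z)^(n - i)

    [eigen_generating_function].  Hence |P| <= S on the unit disk, but also
    |P(i y)| <= S ((1 + y^2) / 2)^(n/2) on the imaginary axis, where 1 - z and
    1 + z have the same modulus.  Since log |P| is subharmonic, on each half of
    the disk cut by this axis log |P| <= log S + n V, where V is the harmonic
    function (the barrier) equal to 0 on the arc and to
    log ((1 + y^2) / 2) / 2 on the diameter.  The outward normal derivative of V on the arc is smallest at its
    middle, where it is 1/2 - 1/pi.  So if c < 1/2 - 1/pi there is a radius
    r < 1 with V < c log r on the circle |z| = r, and Cauchy's estimate on that
    circle bounds the coefficients of index k <= c n by S exp (- gamma n).

    In the proof the half-disk is rotated so that it is the upper one and its
    diameter is [-1, 1]; then V = log (|1 - i z|^2 / 2) / 2 + Re f, where f is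
    (2 i / pi) times an odd power series with real coefficients.  So Re f
    vanishes on the diameter, as it should, and on the arc it has to be
    - log (1 + Im z) / 2.  The coefficients of f that achieve this are explicit
    [leibniz_defect]; the trigonometric identities [defect_cos_sumE] and
    [defect_sin_sumE] reduce the identification of Re f and of its radial
    derivative on the arc to the partial sums of two classical series
    [norm_odd_sin_sum_sub_le, odd_cos_sum_le].  The summand 1/2 of the constant
    is the radial derivative of the logarithm; the summand - 1/pi is - 2/pi
    times the bound 1/2 of [defect_sin_sum_le].

    All of this is done with polynomials.  A polynomial B [weight_poly] takes
    the place of exp (- V), and the maximum principle is applied to p B^n,
    where p(z) = P(- i z) [upper_half_disk_le].  For polynomials it follows from
    the exactness of the mean value over N-th roots of unity, for N larger than
    the degree [half_disk_max]. *)

(** * Real functions of one variable *)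

Lemma derive_ge0_le (R : realType) (f df : R -> R) (a b : R) : a <= b ->
  (forall x, a <= x <= b -> is_derive x 1 f (df x)) ->
  (forall x, a <= x <= b -> 0 <= df x) -> f a <= f b.
Proof.
move=> ab Df df_ge0.
have [x||x xab fE] := @MVT_segment R f df a b ab.
- by rewrite in_itv /= => /andP[/ltW ax /ltW xb]; apply: Df; rewrite ax xb.
- apply: derivable_within_continuous => x; rewrite in_itv /= => xab.
  by apply: ex_derive; exact: Df.
- by rewrite -subr_ge0 fE mulr_ge0 ?subr_ge0 // df_ge0.
Qed.

(** The bound is only asked for inside the interval: it is used where the
    derivative is not controlled at the end points. *)
Lemma derive_norm_le (R : realType) (f df : R -> R) (a b k : R) : a <= b ->
  (forall x, a <= x <= b -> is_derive x 1 f (df x)) ->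
  (forall x, a < x < b -> `|df x| <= k) -> `|f b - f a| <= k * (b - a).
Proof.
rewrite le_eqVlt => /orP[/eqP<- _ _|ab Df df_le]; first by rewrite !subrr normr0 mulr0.
have [x||x xab ->] := @MVT R f df a b ab.
- by rewrite in_itv /= => /andP[/ltW ax /ltW xb]; apply: Df; rewrite ax xb.
- apply: derivable_within_continuous => x; rewrite in_itv /= => xab.
  by apply: ex_derive; exact: Df.
- have ba : 0 <= b - a by rewrite subr_ge0 ltW.
  rewrite normrM (ger0_norm ba) ler_wpM2r // df_le //.
Qed.

Lemma ler_lim_inv (R : realType) (x y a : R) :
  (forall k : nat, x <= y + a / k.+1%:R) -> x <= y.
Proof.
move=> H; rewrite leNgt; apply/negP => yx.
have d_gt0 : 0 < x - y by rewrite subr_gt0.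
pose k := Num.bound (a / (x - y)).
have ak : a < k.+1%:R * (x - y).
  rewrite -ltr_pdivrMr //; apply: le_lt_trans (ler_norm _) _.
  apply: lt_le_trans (archi_boundP (normr_ge0 _)) _.
  by rewrite ler_nat /k /Num.bound normr_id.
have := H k; rewrite -lerBlDl ler_pdivlMr ?ltr0n //.
by rewrite leNgt mulrC ak.
Qed.

Lemma is_derive_sin_mul (R : realType) (k x : R) :
  is_derive x 1 (fun y => sin (k * y)) (k * cos (k * x)).
Proof.
have H : is_derive x 1 ( *%R k) k.
  by apply: is_derive_eq; rewrite scaler1.
by have := is_derive1_comp (is_derive_sin (k * x)) H; rewrite mulrC.
Qed.

Lemma is_derive_cos_mul (R : realType) (k x : R) :
  is_derive x 1 (fun y => cos (k * y)) (- (k * sin (k * x))).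
Proof.
have H : is_derive x 1 ( *%R k) k.
  by apply: is_derive_eq; rewrite scaler1.
by have := is_derive1_comp (is_derive_cos (k * x)) H; rewrite mulNr mulrC.
Qed.

Lemma is_derive_sum_ord (R : realType) (n : nat) (h dh : nat -> R -> R) (x : R) :
  (forall i, is_derive x 1 (h i) (dh i x)) ->
  is_derive x 1 (fun y => \sum_(i < n) h i y) (\sum_(i < n) dh i x).
Proof.
move=> Dh; have := @is_derive_sum R R R n (fun i => h i) x 1 (fun i => dh i x) (fun i => Dh i).
by congr (is_derive _ _ _ _); apply/funext => y; rewrite fct_sumE.
Qed.

Lemma is_derive_monomial (R : realType) (a : R) (n : nat) (x : R) :
  is_derive x 1 (fun y => a * y ^+ n.+1) (a * n.+1%:R * x ^+ n).
Proof.
have H : is_derive x 1 ((fun y : R => y) ^+ n.+1) (n.+1%:R * x ^+ n).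
  apply: is_derive_eq; rewrite /GRing.scale /= mulr1.
  by rewrite -mulr_natl /GRing.exp.
have := @is_deriveZ R R R _ a x 1 _ H.
rewrite /GRing.scale /= mulrA.
by congr (is_derive _ _ _ _); apply/funext => y /=; rewrite fctE.
Qed.

(** * Leibniz's series and the coefficients of the barrier *)

Section LeibnizSeries.
Variable R : realType.
Implicit Types (j m n M : nat) (x : R).

Definition leibniz_sum n : R := \sum_(i < n) (-1) ^+ i / i.*2.+1%:R.

(** The moments of (1 - x ^ 2) / (1 + x ^ 2) for the weights x ^ (2 n) on [0, 1],
    in a closed form that needs no integral.  Up to the factor - 2 / pi they are
    the coefficients of the sine series of the radial derivative of the harmonic
    function Re f of the introduction. *)
Definition leibniz_defect n : R := (-1) ^+ n * (pi / 2 - leibniz_sum n - leibniz_sum n.+1).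

(** Leibniz's series for pi / 4, with its rate: the derivative of the error at x
    in place of 1 is, up to sign, x ^ (2 n) / (1 + x ^ 2). *)
Lemma leibniz_le n : `|pi / 4 - leibniz_sum n| <= n.*2.+1%:R^-1.
Proof.
pose f x : R := atan x - \sum_(i < n) (-1) ^+ i / i.*2.+1%:R * x ^+ i.*2.+1.
pose df x : R := (1 + x ^+ 2)^-1 - \sum_(i < n) (- x ^+ 2) ^+ i.
pose g x : R := x ^+ n.*2.+1 / n.*2.+1%:R.
have Dg x : is_derive x 1 g (x ^+ n.*2).
  have := is_derive_monomial n.*2.+1%:R^-1 n.*2 x.
  rewrite mulVf ?pnatr_eq0 // mul1r.
  by congr (is_derive _ _ _ _); apply/funext => y; rewrite /g mulrC.
have Df x : is_derive x 1 f (df x).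
  apply: is_deriveB.
  apply: (@is_derive_sum_ord _ _ (fun i y => (-1) ^+ i / i.*2.+1%:R * y ^+ i.*2.+1) (fun i y => (- y ^+ 2) ^+ i)) => i.
  have := is_derive_monomial ((-1) ^+ i / i.*2.+1%:R) i.*2 x.
  congr (is_derive _ _ _ _); rewrite mulfVK ?pnatr_eq0 //.
  by rewrite [RHS]exprNn -exprM mul2n.
have dfE x : df x = (- x ^+ 2) ^+ n / (1 + x ^+ 2).
  have x2 : 1 + x ^+ 2 != 0 by rewrite gt_eqF // ltr_pwDl // sqr_ge0.
  apply: (mulIf x2); rewrite mulfVK // mulrBl mulVf //.
  have := subrX1 (- x ^+ 2) n; move=> E.
  by rewrite -[X in 1 - X]opprK -mulrN opprD opprK [-1 + _]addrC; lra.
have df_le x : `|df x| <= x ^+ n.*2.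
  have x2 : 0 < 1 + x ^+ 2 by rewrite ltr_pwDl // sqr_ge0.
  have xn : 0 <= x ^+ n.*2 by rewrite exprn_even_ge0 ?odd_double.
  rewrite dfE normrM normrX normrN normrX -exprM mul2n -normrX.
  rewrite !ger0_norm ?invr_ge0 ?(ltW x2) // ler_piMr //.
  by rewrite invf_le1 // lerDl sqr_ge0.
have f0 : f 0 = 0.
  by rewrite /f atan0 big1 ?subrr // => i _; rewrite expr0n mulr0.
have g0 : g 0 = 0 by rewrite /g expr0n mul0r.
have -> : pi / 4 - leibniz_sum n = f 1.
  by rewrite /f atan1; congr (_ - _); apply: eq_bigr => i _; rewrite expr1n mulr1.
have -> : n.*2.+1%:R^-1 = g 1 by rewrite /g expr1n mul1r.
rewrite ler_norml; apply/andP; split.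
  have : (f + g) 0 <= (f + g) 1.
    apply: (@derive_ge0_le _ _ (fun x => df x + x ^+ n.*2)) => // x _.
    by have := df_le x; rewrite ler_norml => /andP[]; lra.
  rewrite /GRing.add /= f0 g0; lra.
have : (g - f) 0 <= (g - f) 1.
  apply: (@derive_ge0_le _ _ (fun x => x ^+ n.*2 - df x)) => // x _.
  by have := df_le x; rewrite ler_norml => /andP[]; lra.
by rewrite /GRing.add /= /GRing.opp /= f0 g0; lra.
Qed.

End LeibnizSeries.

Section Defects.
Variable R : realType.
Implicit Types (j m n M : nat) (x : R).

Lemma leibniz_defect0 : leibniz_defect R 0 = pi / 2 - 1.
Proof.
by rewrite /leibniz_defect /leibniz_sum big_ord0 big_ord1 expr0 double0 mul1r divr1 subr0.
Qed.

(** With the value at 0, this two-term recurrence is what determines the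
    trigonometric sums below. *)
Lemma leibniz_defectD n :
  leibniz_defect R n + leibniz_defect R n.+1 = n.*2.+1%:R^-1 - n.*2.+3%:R^-1.
Proof.
have s1 : (-1) ^+ n * (-1) ^+ n = 1 :> R by rewrite -expr2 sqrr_sign.
rewrite /leibniz_defect /leibniz_sum !big_ord_recr /= !exprS doubleS.
set L := \sum_(i < n) _; set s := (-1) ^+ n in s1 *.
set a := _.*2.+1%:R^-1; set b := _.*2.+3%:R^-1.
transitivity (s * s * (a - b)); first by field.
by rewrite s1 mul1r.
Qed.

Lemma norm_leibniz_defect_le n : `|leibniz_defect R n| <= 2 / n.+1%:R.
Proof.
rewrite normrM normrX normrN1 expr1n mul1r.
have -> : pi / 2 - leibniz_sum R n - leibniz_sum R n.+1 =
  (pi / 4 - leibniz_sum R n) + (pi / 4 - leibniz_sum R n.+1) by field.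
apply: le_trans (ler_normD _ _) _.
have H k : (n <= k.*2)%N -> k.*2.+1%:R^-1 <= n.+1%:R^-1 :> R.
  by move=> nk; rewrite lef_pV2 ?posrE ?ltr0n // ler_nat.
have := leibniz_le R n; have := leibniz_le R n.+1.
have : n.*2.+1%:R^-1 <= n.+1%:R^-1 :> R by apply: H; lia.
have : n.+1.*2.+1%:R^-1 <= n.+1%:R^-1 :> R by apply: H; lia.
move: (n.+1.*2.+1%:R^-1) (n.*2.+1%:R^-1) (n.+1%:R^-1 : R) => a b c.
lra.
Qed.

(** The terms of equal parity decrease, by the recurrence, and tend to 0. *)
Lemma leibniz_defect_ge0 n : 0 <= leibniz_defect R n.
Proof.
have step m : leibniz_defect R m.+2 <= leibniz_defect R m.
  have E1 := leibniz_defectD m; have E2 := leibniz_defectD m.+1.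
  suff : m.*2.+3%:R^-1 - m.*2.+4.+1%:R^-1 <= m.*2.+1%:R^-1 - m.*2.+3%:R^-1 :> R.
    rewrite doubleS in E2; move: E1 E2.
    move: (m.*2.+1%:R^-1 : R) (m.*2.+3%:R^-1 : R) (m.*2.+4.+1%:R^-1 : R) => a b c.
    by lra.
  have -> : m.*2.+1%:R = 2 * m%:R + 1 :> R by rewrite -natr1 -mul2n natrM.
  have -> : m.*2.+3%:R = 2 * m%:R + 3 :> R by rewrite -addn3 natrD -mul2n natrM.
  have -> : m.*2.+4.+1%:R = 2 * m%:R + 5 :> R by rewrite -[m.*2.+4.+1]/(5 + m.*2)%N natrD -mul2n natrM addrC.
  have m0 : 0 <= m%:R :> R by [].
  rewrite -subr_ge0.
  have -> : (2 * m%:R + 1)^-1 - (2 * m%:R + 3)^-1 - ((2 * m%:R + 3)^-1 - (2 * m%:R + 5)^-1)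
    = 8 / ((2 * m%:R + 1) * (2 * m%:R + 3) * (2 * m%:R + 5)) :> R.
    by field; rewrite !gt_eqF //; lra.
  by rewrite divr_ge0 // !mulr_ge0 // addr_ge0 // mulr_ge0.
have iter k : leibniz_defect R (n + k.*2) <= leibniz_defect R n.
  elim: k => [|k IH]; first by rewrite addn0.
  by rewrite doubleS !addnS; apply: le_trans IH; exact: step.
suff : - leibniz_defect R n <= 0 by rewrite oppr_le0.
apply: (@ler_lim_inv _ _ _ 2) => k; rewrite add0r.
have := norm_leibniz_defect_le (n + k.*2); rewrite ler_norml => /andP[H _].
have := iter k.
suff : 2 / (n + k.*2).+1%:R <= 2 / k.+1%:R :> R.
  by move: H; move: (2 / k.+1%:R : R) (2 / (n + k.*2).+1%:R : R) => a b; lra.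
by rewrite ler_pM2l // lef_pV2 ?posrE ?ltr0n // ler_nat; lia.
Qed.

(** The recurrence bounds each term by a difference that telescopes. *)
Lemma sum_leibniz_defect_le M N : (M <= N)%N ->
  \sum_(M <= j < N) leibniz_defect R j <= M.*2.+1%:R^-1.
Proof.
move=> MN; suff : \sum_(M <= j < N) leibniz_defect R j <= M.*2.+1%:R^-1 - N.*2.+1%:R^-1.
  by move=> H; apply: le_trans H _; rewrite gerBl invr_ge0.
elim: N MN => [|N IH]; first by rewrite leqn0 => /eqP->; rewrite big_geq ?subrr.
rewrite leq_eqVlt => /orP[/eqP<-|]; first by rewrite big_geq ?subrr.
rewrite ltnS => MN; rewrite big_nat_recr //=.
have := IH MN; have := leibniz_defectD N; have := leibniz_defect_ge0 N.+1; rewrite doubleS.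
move: (N.*2.+1%:R^-1 : R) (N.*2.+3%:R^-1 : R) (M.*2.+1%:R^-1 : R) => a b c; lra.
Qed.

End Defects.

(** * Partial sums of trigonometric series *)

Section TrigSums.
Variable R : realType.
Implicit Types (j m n M : nat) (x : R).

Definition odd_sin_sum n x : R :=
  \sum_(j < n) j.*2.+1%:R^-1 * sin (j.*2.+1%:R * x).
Definition odd_cos_sum n x : R :=
  \sum_(j < n) j.*2.+1%:R^-1 * cos (j.*2.+1%:R * x).
Definition defect_sin_sum n x : R := \sum_(j < n) leibniz_defect R j * sin (j.*2.+1%:R * x).
Definition defect_cos_sum n x : R := \sum_(j < n) leibniz_defect R j * cos (j.*2.+1%:R * x).

Lemma angle_odd n x : n.*2.+1%:R * x = n.*2%:R * x + x.
Proof. by rewrite -natr1 mulrDl mul1r. Qed.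

Lemma angle_next n x : n.+1.*2%:R * x = n.*2%:R * x + x + x.
Proof. by rewrite doubleS -!natr1 !mulrDl mul1r. Qed.

(** Multiplying by 2 cos x adds up neighbouring coefficients, and the recurrence
    for the latter leaves the sum for a square wave. *)
Lemma defect_cos_sumE n x :
  2 * cos x * defect_cos_sum n x + 2 * sin x * odd_sin_sum n x =
  pi / 2 - (leibniz_defect R n + n.*2.+1%:R^-1) * cos (n.*2%:R * x).
Proof.
elim: n => [|n IH].
  rewrite /defect_cos_sum /odd_sin_sum !big_ord0 !mulr0 leibniz_defect0 double0 mul0r cos0 invr1.
  by rewrite addr0 mulr1; ring.
rewrite /defect_cos_sum /odd_sin_sum !big_ord_recr /= -/(defect_cos_sum n x) -/(odd_sin_sum n x).
have := leibniz_defectD R n; rewrite angle_next angle_odd doubleS.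
move: IH; rewrite !cosD !sinD.
have := cos2Dsin2 x.
move: (n.*2.+1%:R^-1 : R) (n.*2.+3%:R^-1 : R) (cos x) (sin x) (cos (n.*2%:R * x)) (sin (n.*2%:R * x)) (leibniz_defect R n) (leibniz_defect R n.+1) => a b c s C S j j'.
move: (defect_cos_sum n x) (odd_sin_sum n x) => X Y E1 E2 E3.
have -> : j' = a - b - j by rewrite -E3; ring.
apply/eqP; rewrite -subr_eq0; apply/eqP.
transitivity ((2 * c * X + 2 * s * Y - (pi / 2 - (j + a) * C))
  + (j + a) * C * (c ^+ 2 + s ^+ 2 - 1)); first by ring.
by rewrite E1 E2 !subrr mulr0 addr0.
Qed.

Lemma defect_sin_sumE n x :
  2 * cos x * defect_sin_sum n x - 2 * sin x * odd_cos_sum n x =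
  - (leibniz_defect R n + n.*2.+1%:R^-1) * sin (n.*2%:R * x).
Proof.
elim: n => [|n IH].
  by rewrite /defect_sin_sum /odd_cos_sum !big_ord0 !mulr0 double0 mul0r sin0 mulr0 subrr.
rewrite /defect_sin_sum /odd_cos_sum !big_ord_recr /= -/(defect_sin_sum n x) -/(odd_cos_sum n x).
have := leibniz_defectD R n; rewrite angle_next angle_odd doubleS.
move: IH; rewrite !cosD !sinD !cosD.
have := cos2Dsin2 x.
move: (n.*2.+1%:R^-1 : R) (n.*2.+3%:R^-1 : R) (cos x) (sin x) (cos (n.*2%:R * x)) (sin (n.*2%:R * x)) (leibniz_defect R n) (leibniz_defect R n.+1) => a b c s C S j j'.
move: (defect_sin_sum n x) (odd_cos_sum n x) => X Y E1 E2 E3.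
have -> : j' = a - b - j by rewrite -E3; ring.
apply/eqP; rewrite -subr_eq0; apply/eqP.
transitivity ((2 * c * X - 2 * s * Y - (- (j + a) * S))
  + (j + a) * S * (c ^+ 2 + s ^+ 2 - 1)); first by ring.
by rewrite E1 E2 !subrr mulr0 addr0.
Qed.

Lemma sum_cos_odd n x :
  2 * sin x * \sum_(j < n) cos (j.*2.+1%:R * x) = sin (n.*2%:R * x).
Proof.
elim: n => [|n IH]; first by rewrite big_ord0 mulr0 double0 mul0r sin0.
rewrite big_ord_recr /= mulrDr IH angle_next angle_odd !cosD !sinD cosD.
move: (cos2Dsin2 x).
move: (cos x) (sin x) (cos (n.*2%:R * x)) (sin (n.*2%:R * x)) => c s C S E.
apply/eqP; rewrite -subr_eq0; apply/eqP.
transitivity (S * (1 - (c ^+ 2 + s ^+ 2))); first by ring.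
by rewrite E subrr mulr0.
Qed.

Lemma sum_sin_odd n x :
  2 * sin x * \sum_(j < n) sin (j.*2.+1%:R * x) = 1 - cos (n.*2%:R * x).
Proof.
elim: n => [|n IH]; first by rewrite big_ord0 mulr0 double0 mul0r cos0 subrr.
rewrite big_ord_recr /= mulrDr IH angle_next angle_odd !cosD !sinD.
move: (cos2Dsin2 x).
move: (cos x) (sin x) (cos (n.*2%:R * x)) (sin (n.*2%:R * x)) => c s C S E.
apply/eqP; rewrite -subr_eq0; apply/eqP.
transitivity (C * ((c ^+ 2 + s ^+ 2) - 1)); first by ring.
by rewrite E subrr mulr0.
Qed.

Lemma is_derive_odd_sin_sum n x :
  is_derive x 1 (odd_sin_sum n) (\sum_(j < n) cos (j.*2.+1%:R * x)).
Proof.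
apply: (@is_derive_sum_ord _ _ (fun j y => j.*2.+1%:R^-1 * sin (j.*2.+1%:R * y))
  (fun j y => cos (j.*2.+1%:R * y))) => j.
have := @is_deriveZ R R R _ j.*2.+1%:R^-1 x 1 _ (is_derive_sin_mul j.*2.+1%:R x).
by rewrite /GRing.scale /= mulKf ?pnatr_eq0.
Qed.

Lemma is_derive_odd_cos_sum n x :
  is_derive x 1 (odd_cos_sum n) (- \sum_(j < n) sin (j.*2.+1%:R * x)).
Proof.
rewrite -sumrN.
apply: (@is_derive_sum_ord _ _ (fun j y => j.*2.+1%:R^-1 * cos (j.*2.+1%:R * y))
  (fun j y => - sin (j.*2.+1%:R * y))) => j.
have := @is_deriveZ R R R _ j.*2.+1%:R^-1 x 1 _ (is_derive_cos_mul j.*2.+1%:R x).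
by rewrite /GRing.scale /= mulrN mulKf ?pnatr_eq0.
Qed.

Lemma sin_odd_pihalf n : sin (n.*2.+1%:R * (pi / 2)) = (-1) ^+ n :> R.
Proof.
elim: n => [|n IH]; first by rewrite mul1r sin_pihalf.
rewrite exprS mulN1r -IH -sinDpi; congr sin.
by rewrite doubleS -natr1 -[in LHS]natr1; field.
Qed.

Lemma cos_odd_pihalf n : cos (n.*2.+1%:R * (pi / 2)) = 0 :> R.
Proof.
elim: n => [|n IH]; first by rewrite mul1r cos_pihalf.
have -> : n.+1.*2.+1%:R * (pi / 2) = n.*2.+1%:R * (pi / 2) + pi :> R.
  by rewrite doubleS -natr1 -[in LHS]natr1; field.
by rewrite cosDpi IH oppr0.
Qed.

Lemma odd_sin_sum_pihalf n : odd_sin_sum n (pi / 2) = leibniz_sum R n.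
Proof.
by apply: eq_bigr => j _; rewrite sin_odd_pihalf mulrC.
Qed.

Lemma odd_cos_sum_pihalf n : odd_cos_sum n (pi / 2) = 0.
Proof. by apply: big1 => j _; rewrite cos_odd_pihalf mulr0. Qed.

End TrigSums.

(** * Partial sums of square waves *)

Section TrigBounds.
Variable R : realType.
Implicit Types (j m n M : nat) (x : R).

Lemma is_derive_div_sin (h : R -> R) (dh x : R) : sin x != 0 ->
  is_derive x 1 h dh ->
  is_derive x 1 (fun y => h y / (2 * sin y))
    ((dh * sin x - h x * cos x) / (2 * sin x ^+ 2)).
Proof.
move=> sx Dh.
have Dv := is_deriveV sx (is_derive_sin x).
have := @is_deriveM _ _ (2^-1 *: h) (fun y => (sin y)^-1) x 1 _ _ (is_deriveZ 2^-1 Dh) Dv.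
rewrite /GRing.scale /=; congr (is_derive _ _ _ _).
  apply/funext => y; rewrite invfM.
  rewrite [LHS]/GRing.mul /= /GRing.scale /=; ring.
by rewrite /GRing.scale /= -!exprVn expr2; field.
Qed.

Lemma pihalf_itv x y : 0 < x -> x <= y <= pi / 2 -> 0 < sin y /\ 0 <= cos y.
Proof.
move=> x_gt0 /andP[xy yp]; have pi0 := pi_gt0 R; split.
  by apply: sin_gt0_pi; lra.
by apply: cos_ge0_pihalf; lra.
Qed.

(** The derivative of the partial sum of the square wave is
    sin (2 n x) / (2 sin x).  Adding (cos (2 n x) + e) / (4 n sin x), which is one
    integration by parts, makes it of constant sign for e = 1 and e = -1. *)
Lemma norm_odd_sin_sum_sub_le n x : (0 < n)%N -> 0 < x <= pi / 2 ->
  `|odd_sin_sum n x - leibniz_sum R n| <= (n.*2%:R * sin x)^-1.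
Proof.
move=> n_gt0 /andP[x_gt0 xp].
pose K : R := n.*2%:R; have K_gt0 : 0 < K by rewrite ltr0n double_gt0.
pose h e y := (cos (K * y) + e) / K.
pose U e y := odd_sin_sum n y + h e y / (2 * sin y).
pose dU e y := - ((cos (K * y) + e) * cos y / (2 * K * sin y ^+ 2)).
have DU e y : x <= y <= pi / 2 -> is_derive y 1 (U e) (dU e y).
  move=> /(pihalf_itv x_gt0)[s_gt0 _]; have sn0 := lt0r_neq0 s_gt0.
  have Dh : is_derive y 1 (h e) (- sin (K * y)).
    have := @is_deriveZ R R R _ K^-1 y 1 _ (is_deriveD (is_derive_cos_mul K y) (is_derive_cst e y 1)).
    rewrite /GRing.scale /= addr0 mulrN mulKf ?lt0r_neq0 //.
    by congr (is_derive _ _ _ _); apply/funext => z; rewrite /h mulrC.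
  have := is_deriveD (is_derive_odd_sin_sum n y) (is_derive_div_sin sn0 Dh).
  congr (is_derive _ _ _ _); rewrite /dU /h.
  have -> : \sum_(j < n) cos (j.*2.+1%:R * y) = sin (K * y) / (2 * sin y).
    by rewrite -sum_cos_odd mulrC mulKf // mulf_neq0.
  by field; rewrite sn0 lt0r_neq0.
have dU_le e y : x <= y <= pi / 2 -> 0 <= (cos (K * y) + e) -> dU e y <= 0.
  move=> /(pihalf_itv x_gt0)[s_gt0 c0] e0; rewrite oppr_le0.
  by rewrite divr_ge0 ?mulr_ge0 // ?exprn_ge0 ltW.
have dU_ge e y : x <= y <= pi / 2 -> (cos (K * y) + e) <= 0 -> 0 <= dU e y.
  move=> /(pihalf_itv x_gt0)[s_gt0 c0] e0; rewrite oppr_ge0 -oppr_ge0 -2!mulNr.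
  rewrite divr_ge0 ?mulr_ge0 ?oppr_ge0 // ?exprn_ge0 // ltW //.
have [s_gt0 _] : 0 < sin x /\ 0 <= cos x by apply: (pihalf_itv x_gt0); rewrite lexx.
have up : U (-1) x <= U (-1) (pi / 2).
  apply: (derive_ge0_le xp (DU (-1))) => y xy; exact: dU_ge.
have dn : - U 1 x <= - U 1 (pi / 2).
  apply: (@derive_ge0_le _ (- U 1) (fun y => - dU 1 y)) => // y xy.
    by apply: is_deriveN; exact: DU.
  rewrite oppr_ge0; apply: dU_le => //; have := cos_geN1 (K * y); lra.
move: up dn; rewrite /U /h sin_pihalf odd_sin_sum_pihalf mulr1.
set s := sin x; set a := cos (K * x); set b := cos (K * _).
set L := leibniz_sum R n; set Y := odd_sin_sum n x => up dn.
have Ks : 0 < (K * s)^-1 by rewrite invr_gt0 mulr_gt0.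
have Ea e : (a + e) / K / (2 * s) = (a + e) / 2 * (K * s)^-1.
  by field; rewrite !lt0r_neq0.
have Kb : 0 < K^-1 by rewrite invr_gt0.
have Eb e : (b + e) / K / 2 = (b + e) / 2 * K^-1.
  by field; rewrite !lt0r_neq0.
move: up dn; rewrite !Ea !Eb.
have a1 := cos_le1 (K * x); have a2 := cos_geN1 (K * x).
have b1 := cos_le1 (K * (pi / 2)); have b2 := cos_geN1 (K * (pi / 2)).
move: a1 a2 b1 b2; rewrite -/a -/b.
clear Ea Eb; move: a b (K * s)^-1 K^-1 Ks Kb => a b u v u0 v0 a1 a2 b1 b2 up dn.
have [? ? ? ?] : [/\ 0 <= (1 - a) * u, 0 <= (1 + a) * u, 0 <= (1 - b) * v & 0 <= (1 + b) * v].
  by split; apply: mulr_ge0; lra.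
rewrite ler_norml; apply/andP; split; lra.
Qed.

(** The sums tend to artanh (cos x) / 2, which is at most cot x / 2.  As for the
    sines, a term in sin (2 n x) absorbs the oscillation of the derivative; the
    difference of the two sides is then monotone and of the right sign at
    pi / 2. *)
Lemma odd_cos_sum_le n x : (0 < n)%N -> 0 < x <= pi / 2 ->
  odd_cos_sum n x <= (cos x + 2 / n.*2%:R) / (2 * sin x).
Proof.
move=> n_gt0 /andP[x_gt0 xp].
pose K : R := n.*2%:R; have K_gt0 : 0 < K by rewrite ltr0n double_gt0.
pose h y := cos y + (1 + sin (K * y)) / K.
pose W y := odd_cos_sum n y - h y / (2 * sin y).
pose dW y := (1 - sin y + (1 + sin (K * y)) * cos y / K) / (2 * sin y ^+ 2).
have DW y : x <= y <= pi / 2 -> is_derive y 1 W (dW y).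
  move=> /(pihalf_itv x_gt0)[s_gt0 _]; have sn0 := lt0r_neq0 s_gt0.
  have Dh : is_derive y 1 h (- sin y + cos (K * y)).
    have := @is_deriveZ R R R _ K^-1 y 1 _ (is_deriveD (is_derive_cst (1 : R) y 1) (is_derive_sin_mul K y)).
    move=> /(is_deriveD (is_derive_cos y)).
    rewrite /GRing.scale /= add0r mulKf ?lt0r_neq0 //.
    by congr (is_derive _ _ _ _); apply/funext => z; rewrite /h mulrC.
  have := is_deriveB (is_derive_odd_cos_sum n y) (is_derive_div_sin sn0 Dh).
  congr (is_derive _ _ _ _); rewrite /dW /h.
  have -> : \sum_(j < n) sin (j.*2.+1%:R * y) = (1 - cos (K * y)) / (2 * sin y).
    by rewrite -sum_sin_odd mulrC mulKf // mulf_neq0.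
  rewrite -[X in (X - _ + _) / _](cos2Dsin2 y).
  by field; rewrite sn0 lt0r_neq0.
have : W x <= W (pi / 2).
  apply: (derive_ge0_le xp DW) => y /(pihalf_itv x_gt0)[s_gt0 c_ge0].
  rewrite divr_ge0 ?mulr_ge0 ?exprn_ge0 ?(ltW s_gt0) //.
  rewrite addr_ge0 ?subr_ge0 ?sin_le1 // divr_ge0 ?(ltW K_gt0) // mulr_ge0 //.
have [s_gt0 _] : 0 < sin x /\ 0 <= cos x by apply: (pihalf_itv x_gt0); rewrite lexx.
rewrite /W odd_cos_sum_pihalf => H.
have : W (pi / 2) <= 0.
  rewrite /W odd_cos_sum_pihalf sub0r oppr_le0 /h cos_pihalf add0r sin_pihalf.
  rewrite !divr_ge0 ?(ltW K_gt0) ?mulr1 //.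
rewrite /W odd_cos_sum_pihalf => /(le_trans H); rewrite subr_le0 => /le_trans; apply.
rewrite ler_pM2r ?invr_gt0 ?mulr_gt0 // lerD2l ler_pM2r ?invr_gt0 //.
by have := sin_le1 (K * x); lra.
Qed.

End TrigBounds.

(** * The barrier and its radial derivative on the arc *)

Section Limits.
Variable R : realType.
Implicit Types (j m n M : nat) (x : R).

Lemma defect_sum_tail_le (u : nat -> R) M N : (M <= N)%N -> (forall j, `|u j| <= 1) ->
  `|\sum_(j < N) leibniz_defect R j * u j - \sum_(j < M) leibniz_defect R j * u j| <= M.*2.+1%:R^-1.
Proof.
move=> MN u_le; rewrite -(big_mkord xpredT (fun j => leibniz_defect R j * u j)).
rewrite -(big_mkord xpredT (fun j => leibniz_defect R j * u j)).
rewrite (big_cat_nat (leq0n M) MN) /= addrAC subrr add0r.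
apply: le_trans (ler_norm_sum _ _ _) _; apply: le_trans (sum_leibniz_defect_le R MN).
apply: ler_sum => j _; rewrite normrM ger0_norm ?leibniz_defect_ge0 //.
by rewrite ler_piMr ?leibniz_defect_ge0.
Qed.

Lemma defect_remainder_le M k : `|leibniz_defect R (M + k.+1) + (M + k.+1).*2.+1%:R^-1| <= 3 / k.+1%:R.
Proof.
have H j : (k <= j)%N -> j.+1%:R^-1 <= k.+1%:R^-1 :> R.
  by move=> kj; rewrite lef_pV2 ?posrE ?ltr0n // ler_nat.
have H1 : (M + k.+1).*2.+1%:R^-1 <= k.+1%:R^-1 :> R by apply: H; lia.
have H2 : (M + k.+1).+1%:R^-1 <= k.+1%:R^-1 :> R by apply: H; lia.
apply: le_trans (ler_normD _ _) _; rewrite (@ger0_norm _ _^-1) ?invr_ge0 //.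
have := norm_leibniz_defect_le R (M + k.+1); move: H1 H2.
move: ((M + k.+1).+1%:R^-1 : R) (k.+1%:R^-1 : R) ((M + k.+1).*2.+1%:R^-1 : R) => a q b.
by move: `|leibniz_defect _ _| => J; lra.
Qed.

(** The identity for the sum contains a factor cos x that vanishes at pi / 2, so
    it only identifies the limit pointwise; the error bound, uniform in x, comes
    from the absolute convergence of the series. *)
Lemma norm_defect_cos_sum_sub_le M x : 0 < x < pi / 2 ->
  `|defect_cos_sum M x - pi / 4 * (cos x / (1 + sin x))| <= M.*2.+1%:R^-1.
Proof.
move=> /andP[x_gt0 xp].
have s_gt0 : 0 < sin x by apply: sin_gt0_pihalf; rewrite x_gt0.
have c_gt0 : 0 < cos x by apply: cos_gt0_pihalf; rewrite xp andbT; have := pi_gt0 R; lra.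
(* 7 = 2 + 2 + 3: twice the error of the square wave, twice that of its value
   pi / 4, and the remainder of the identity. *)
apply: (@ler_lim_inv _ _ _ (7 / (2 * cos x))) => k.
pose N := (M + k.+1)%N.
have MN : (M <= N)%N by rewrite leq_addr.
set T := pi / 4 * _.
have E : defect_cos_sum M x - T = (defect_cos_sum N x - T) - (defect_cos_sum N x - defect_cos_sum M x) by ring.
rewrite E; apply: le_trans (ler_normB _ _) _; rewrite addrC lerD //.
  by apply: (defect_sum_tail_le (u := fun j => cos (j.*2.+1%:R * x)) MN) => j; exact: cos_max.
have s1 : 1 + sin x != 0 by rewrite gt_eqF // ltr_wpDr // ltW.
have cT : 2 * cos x * T = pi / 2 * (1 - sin x).
  have -> : 2 * cos x * T = pi / 2 * (cos x ^+ 2 / (1 + sin x)) by rewrite /T; field.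
  by rewrite cos2sin2; field.
have := defect_cos_sumE N x; set al := leibniz_defect R N + _.
have al_le : `|al| <= 3 / k.+1%:R by exact: defect_remainder_le.
have S_le : `|odd_sin_sum N x - leibniz_sum R N| <= (N.*2%:R * sin x)^-1.
  by apply: norm_odd_sin_sum_sub_le; [rewrite /N addnS | lra].
have L_le := leibniz_le R N.
have kN : (k.+1 <= N.*2)%N by rewrite -addnn (leq_trans (leq_addl M _)) ?leq_addr.
have q1 : N.*2.+1%:R^-1 <= k.+1%:R^-1 :> R.
  by rewrite lef_pV2 ?posrE ?ltr0n // ler_nat leqW.
have q2 : N.*2%:R^-1 <= k.+1%:R^-1 :> R.
  by rewrite lef_pV2 ?posrE ?ltr0n ?(leq_trans _ kN) // ler_nat.
move=> main.
have sS_le : `|sin x * (odd_sin_sum N x - leibniz_sum R N)| <= k.+1%:R^-1.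
  rewrite normrM (gtr0_norm s_gt0); apply: le_trans q2.
  by rewrite -ler_pdivlMl // -invfM mulrC.
have sL_le : `|sin x * (pi / 4 - leibniz_sum R N)| <= k.+1%:R^-1.
  rewrite normrM (gtr0_norm s_gt0); apply: le_trans q1.
  apply: le_trans L_le; rewrite ler_piMl //; exact: sin_le1.
have aC_le : `|al * cos (N.*2%:R * x)| <= 3 * k.+1%:R^-1.
  rewrite normrM; apply: le_trans al_le; rewrite ler_piMr //; exact: cos_max.
have -> : defect_cos_sum N x - T = (2 * cos x * defect_cos_sum N x - 2 * cos x * T) / (2 * cos x).
  by field; rewrite gt_eqF.
rewrite normrM (@gtr0_norm _ _^-1) ?invr_gt0 ?mulr_gt0 //.
rewrite [leRHS]mulrAC ler_pM2r ?invr_gt0 ?mulr_gt0 // cT.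
move: main sS_le sL_le aC_le.
move: (al * _) (k.+1%:R^-1 : R) => b q main.
rewrite !ler_norml => /andP[? ?] /andP[? ?] /andP[? ?].
by apply/andP; split; lra.
Qed.

(** The bound 1/2 is the value of the full series at pi / 2, where it is maximal.
    It is where the constant 1 / pi comes from. *)
Lemma defect_sin_sum_le_oo M x : 0 < x < pi / 2 -> defect_sin_sum M x <= 2^-1 + M.*2.+1%:R^-1.
Proof.
move=> /andP[x_gt0 xp].
have s_gt0 : 0 < sin x by apply: sin_gt0_pihalf; rewrite x_gt0.
have c_gt0 : 0 < cos x by apply: cos_gt0_pihalf; rewrite xp andbT; have := pi_gt0 R; lra.
(* 5 = 2 + 3: the error of the cosine sum and the remainder of the identity. *)
apply: (@ler_lim_inv _ _ _ (5 / (2 * cos x))) => k.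
pose N := (M + k.+1)%N.
have MN : (M <= N)%N by rewrite leq_addr.
have := @defect_sum_tail_le (fun j => sin (j.*2.+1%:R * x)) M N MN (fun j => sin_max _).
rewrite -/(defect_sin_sum _ _) -/(defect_sin_sum _ _) ler_norml => /andP[tail _].
suff : defect_sin_sum N x <= 2^-1 + 5 / (2 * cos x) / k.+1%:R.
  move: tail; move: (M.*2.+1%:R^-1 : R) (5 / _ / _) => a b; lra.
have := defect_sin_sumE N x; set al := leibniz_defect R N + _.
have al_le : `|al| <= 3 / k.+1%:R by exact: defect_remainder_le.
have C_le : odd_cos_sum N x <= (cos x + 2 / N.*2%:R) / (2 * sin x).
  by apply: odd_cos_sum_le; [rewrite /N addnS | lra].
have kN : (k.+1 <= N.*2)%N by rewrite -addnn (leq_trans (leq_addl M _)) ?leq_addr.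
have q2 : N.*2%:R^-1 <= k.+1%:R^-1 :> R.
  by rewrite lef_pV2 ?posrE ?ltr0n ?(leq_trans _ kN) // ler_nat.
have sC_le : 2 * sin x * odd_cos_sum N x <= cos x + 2 * k.+1%:R^-1.
  rewrite -ler_pdivlMl ?mulr_gt0 //; apply: le_trans C_le _.
  by rewrite mulrC ler_pM2l ?invr_gt0 ?mulr_gt0 // lerD2l ler_pM2l.
have aS_le : `|al * sin (N.*2%:R * x)| <= 3 * k.+1%:R^-1.
  rewrite normrM; apply: le_trans al_le; rewrite ler_piMr //; exact: sin_max.
have -> : 2^-1 + 5 / (2 * cos x) / k.+1%:R = (cos x + 5 * k.+1%:R^-1) / (2 * cos x).
  by field; rewrite gt_eqF //= pnatr_eq0.
rewrite ler_pdivlMr ?mulr_gt0 // mulrC.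
move: sC_le aS_le; rewrite mulNr.
move: (al * _) (k.+1%:R^-1 : R) => b q.
by rewrite ler_norml => ? /andP[? ?] ?; lra.
Qed.

Lemma is_derive_defect_sin_sum M x :
  is_derive x 1 (defect_sin_sum M) (\sum_(j < M) leibniz_defect R j * (j.*2.+1%:R * cos (j.*2.+1%:R * x))).
Proof.
apply: (@is_derive_sum_ord _ _ (fun j y => leibniz_defect R j * sin (j.*2.+1%:R * y))
  (fun j y => leibniz_defect R j * (j.*2.+1%:R * cos (j.*2.+1%:R * y)))) => j.
exact: (@is_deriveZ R R R _ (leibniz_defect R j) x 1 _ (is_derive_sin_mul j.*2.+1%:R x)).
Qed.

(** At pi / 2 the bound holds by continuity. *)
Lemma defect_sin_sum_le_pihalf M x : 0 <= x <= pi / 2 -> defect_sin_sum M x <= 2^-1 + M.*2.+1%:R^-1.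
Proof.
have pi0 := pi_gt0 R.
rewrite le_eqVlt => /andP[/orP[/eqP<- _|x_gt0]].
  rewrite /defect_sin_sum big1 ?addr_ge0 ?invr_ge0 // => j _.
  by rewrite mulr0 sin0 mulr0.
rewrite le_eqVlt => /orP[/eqP->|xp]; last by apply: defect_sin_sum_le_oo; rewrite x_gt0.
pose B : R := \sum_(j < M) `|leibniz_defect R j * j.*2.+1%:R|.
apply: (@ler_lim_inv _ _ _ B) => k.
pose d : R := k.+1%:R^-1.
have d_gt0 : 0 < d by rewrite invr_gt0.
have d_le : d <= 1 by rewrite invf_le1 // ler1n.
have p1 := pihalf_ge1 R.
pose e := d / 2.
have := @defect_sin_sum_le_oo M (pi / 2 - e) ltac:(rewrite /e; lra).
have := @derive_norm_le R (defect_sin_sum M) _ (pi / 2 - e) (pi / 2) B _ (fun y _ => is_derive_defect_sin_sum M y) _.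
have -> : pi / 2 - (pi / 2 - e) = e by ring.
move=> H; have {H} : `|defect_sin_sum M (pi / 2) - defect_sin_sum M (pi / 2 - e)| <= B * e.
  apply: H => [|y _]; first by rewrite /e; lra.
  apply: le_trans (ler_norm_sum _ _ _) _; apply: ler_sum => j _.
  by rewrite mulrA normrM ler_piMr // cos_max.
rewrite ler_norml => /andP[_].
have : B * e <= B * d by rewrite ler_wpM2l ?sumr_ge0 // /e; lra.
rewrite -/d; move: (M.*2.+1%:R^-1 : R) (B * e) (B * d) => a b c; lra.
Qed.

Lemma sin_odd_reflect n x : sin (n.*2.+1%:R * (pi - x)) = sin (n.*2.+1%:R * x).
Proof.
have E j y : sin (j.*2.+1%:R * pi - y) = sin y.
  elim: j => [|j IH]; first by rewrite mul1r addrC sinDpi sinN opprK.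
  have -> : j.+1.*2.+1%:R * pi - y = j.*2.+1%:R * pi - y + pi *+ 2.
    by rewrite doubleS -natr1 -[in LHS]natr1; ring.
  by rewrite sinD2pi.
by rewrite mulrBr E.
Qed.

Lemma sin_reflect x : sin (pi - x) = sin x.
Proof. by have := sin_odd_reflect 0 x; rewrite !mul1r. Qed.

Lemma defect_sin_sum_le M x : 0 <= x <= pi -> defect_sin_sum M x <= 2^-1 + M.*2.+1%:R^-1.
Proof.
move=> /andP[x0 xp]; have [xh|xh] := leP x (pi / 2).
  by apply: defect_sin_sum_le_pihalf; rewrite x0.
have -> : defect_sin_sum M x = defect_sin_sum M (pi - x).
  by apply: eq_bigr => j _; rewrite sin_odd_reflect.
by apply: defect_sin_sum_le_pihalf; lra.
Qed.

Definition defect_int_sum n x : R :=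
  \sum_(j < n) leibniz_defect R j / j.*2.+1%:R * sin (j.*2.+1%:R * x).

Lemma is_derive_defect_int_sum M x : is_derive x 1 (defect_int_sum M) (defect_cos_sum M x).
Proof.
apply: (@is_derive_sum_ord _ _ (fun j y => leibniz_defect R j / j.*2.+1%:R * sin (j.*2.+1%:R * y))
  (fun j y => leibniz_defect R j * cos (j.*2.+1%:R * y))) => j.
have := @is_deriveZ R R R _ (leibniz_defect R j / j.*2.+1%:R) x 1 _ (is_derive_sin_mul j.*2.+1%:R x).
by rewrite /GRing.scale /= mulrA mulfVK ?pnatr_eq0.
Qed.

(** Integration of the estimate of the derivative from 0. *)
Lemma norm_defect_int_sum_sub_le M x : 0 <= x <= pi ->
  `|defect_int_sum M x - pi / 4 * ln (1 + sin x)| <= 2 / M.*2.+1%:R.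
Proof.
have pi0 := pi_gt0 R.
wlog : x / x <= pi / 2.
  move=> H /andP[x0 xp]; have [xh|xh] := leP x (pi / 2); first by apply: H; rewrite // x0.
  have -> : defect_int_sum M x = defect_int_sum M (pi - x).
    by apply: eq_bigr => j _; rewrite sin_odd_reflect.
  by rewrite -sin_reflect; apply: H; lra.
move=> xh /andP[x0 _].
pose f y := defect_int_sum M y - pi / 4 * ln (1 + sin y).
have Df y : 0 <= y <= x -> is_derive y 1 f (defect_cos_sum M y - pi / 4 * (cos y / (1 + sin y))).
  move=> yx; have s0 : 0 <= sin y by apply: sin_ge0_pi; lra.
  have s1 : 0 < 1 + sin y by rewrite ltr_pwDl.
  apply: is_deriveB; first exact: is_derive_defect_int_sum.
  have D1 : is_derive y 1 (fun y => 1 + sin y) (cos y).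
    have := is_deriveD (is_derive_cst (1 : R) y 1) (is_derive_sin y).
    by rewrite add0r.
  have D2 := @is_derive1_comp R (@ln R) (fun y => 1 + sin y) y _ _ (is_derive1_ln s1) D1.
  have := @is_deriveZ R R R _ (pi / 4) y 1 _ D2.
  by congr (is_derive _ _ _ _); rewrite [cos y / _]mulrC.
have f0 : f 0 = 0.
  rewrite /f sin0 addr0 ln1 mulr0 subr0 /defect_int_sum big1 // => j _.
  by rewrite mulr0 sin0 mulr0.
have := @derive_norm_le R f _ 0 x M.*2.+1%:R^-1 x0 Df.
rewrite f0 !subr0 => H; apply: le_trans (H _) _ => [y|].
  by move=> ?; apply: norm_defect_cos_sum_sub_le; lra.
rewrite mulrC ler_pM2r ?invr_gt0 //.
by have := pihalf_lt2 R; lra.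
Qed.

End Limits.

(** * Complex numbers: modulus *)

Section Modulus.
Local Open Scope complex_scope.
Variable R : realType.
Implicit Types (z w : R[i]) (x y : R).

(** The real-valued modulus: the norm of R[i] takes its values in R[i]. *)
Definition cmod z : R := Num.sqrt (complex.Re z ^+ 2 + complex.Im z ^+ 2).

Lemma cmodE z : `|z| = (cmod z)%:C.
Proof. exact: normc_def. Qed.

Lemma cmod_ge0 z : 0 <= cmod z.
Proof. exact: sqrtr_ge0. Qed.

Lemma sqr_cmod z : cmod z ^+ 2 = complex.Re z ^+ 2 + complex.Im z ^+ 2.
Proof. by rewrite sqr_sqrtr // addr_ge0 // sqr_ge0. Qed.

Lemma cmodM z w : cmod (z * w) = cmod z * cmod w.
Proof. by apply: (@complexI R); rewrite rmorphM /= -!cmodE normrM. Qed.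

Lemma cmodX z n : cmod (z ^+ n) = cmod z ^+ n.
Proof. by apply: (@complexI R); rewrite rmorphXn /= -!cmodE normrX. Qed.

Lemma cmodD z w : cmod (z + w) <= cmod z + cmod w.
Proof. by rewrite -lecR rmorphD /= -!cmodE ler_normD. Qed.

Lemma cmodN z : cmod (- z) = cmod z.
Proof. by apply: (@complexI R); rewrite -!cmodE normrN. Qed.

Lemma cmod_sum n (F : 'I_n -> R[i]) : cmod (\sum_(i < n) F i) <= \sum_(i < n) cmod (F i).
Proof.
rewrite -lecR rmorph_sum /= -cmodE; apply: le_trans (ler_norm_sum _ _ _) _.
by apply: ler_sum => i _; rewrite cmodE.
Qed.

Lemma cmod_real x : cmod x%:C = `|x|.
Proof. by rewrite /cmod /= expr0n addr0 sqrtr_sqr. Qed.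

Lemma cmod1 : cmod 1 = 1.
Proof. by have := cmod_real 1; rewrite normr1. Qed.

Lemma cmod_i : cmod 'i = 1.
Proof. by rewrite /cmod /= expr0n add0r expr1n sqrtr1. Qed.

Lemma norm_Re_le z : `|complex.Re z| <= cmod z.
Proof. by rewrite -lecR -cmodE normc_ge_Re. Qed.

Lemma norm_Im_le z : `|complex.Im z| <= cmod z.
Proof. by rewrite -sqrtr_sqr ler_sqrt ?addr_ge0 ?sqr_ge0 // lerDr sqr_ge0. Qed.

Lemma ImD z w : complex.Im (z + w) = complex.Im z + complex.Im w.
Proof. by case: z w => [a b] [c d]. Qed.

Lemma Im_sum n (F : 'I_n -> R[i]) :
  complex.Im (\sum_(i < n) F i) = \sum_(i < n) complex.Im (F i).
Proof. by apply: (big_morph (@complex.Im R)) => // z w; rewrite ImD. Qed.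

Lemma ImZ x z : complex.Im (x%:C * z) = x * complex.Im z.
Proof. by case: z => [a b] /=; rewrite mul0r addr0. Qed.

End Modulus.

(** * Mean values over roots of unity *)

Section RootsOfUnity.
Local Open Scope complex_scope.
Variable R : realType.
Implicit Types (z w : R[i]) (x y : R).

(** Powers of 2 suffice, and are reached by repeated square roots of -1. *)
Lemma prim_root_exists k : exists w : R[i], (2 ^ k.+1).-primitive_root w.
Proof.
have [w wE] : exists w : R[i], w ^+ (2 ^ k) = -1.
  elim: k => [|k [w wE]]; first by exists (-1); rewrite expr1.
  by exists (sqrtC w); rewrite expnS exprM sqrtCK.
exists w; have w1 : w ^+ (2 ^ k.+1) = 1 by rewrite expnSr exprM wE sqrrN expr1n.
have [m wm] := prim_order_exists (expn_gt0 2 k.+1) w1.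
case/(dvdn_pfactor _ _ (isT : prime 2)) => e ek mE; move: wm; rewrite mE.
move: ek; rewrite leq_eqVlt => /orP[/eqP->//|ek] wm.
have : w ^+ (2 ^ k) == 1 by rewrite -(prim_order_dvd wm) dvdn_exp2l.
by rewrite wE eq_sym -subr_eq0 opprK -(natrD _ 1 1) pnatr_eq0.
Qed.

Lemma cmod_prim_root N w j : N.-primitive_root w -> cmod (w ^+ j) = 1.
Proof.
move=> wN; rewrite cmodX; suff -> : cmod w = 1 by rewrite expr1n.
apply/eqP; rewrite -(@pexpr_eq1 _ (cmod w) N) ?cmod_ge0 ?(prim_order_gt0 wN) //.
by rewrite -cmodX (prim_expr_order wN) cmod1.
Qed.

Lemma sum_prim_root N w m : N.-primitive_root w ->
  \sum_(j < N) w ^+ (j * m) = (if (N %| m)%N then N%:R else 0 : R[i]).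
Proof.
move=> wN; under eq_bigr do rewrite mulnC exprM.
rewrite (prim_order_dvd wN); case: eqP => [->|/eqP wm].
  by under eq_bigr do rewrite expr1n; rewrite sumr_const card_ord.
have wm1 : w ^+ m - 1 != 0 by rewrite subr_eq0.
apply: (mulfI wm1); rewrite mulr0 -subrX1 -exprM mulnC exprM.
by rewrite (prim_expr_order wN) expr1n subrr.
Qed.

(** Extraction of a coefficient by the discrete Fourier transform; N - k stands
    for - k, to keep exponents in nat. *)
Lemma coef_prim_root N w (q : {poly R[i]}) k : N.-primitive_root w ->
  (size q <= N)%N -> (k < N)%N ->
  \sum_(j < N) q.[w ^+ j] * w ^+ (j * (N - k)) = N%:R * q`_k.
Proof.
move=> wN qN kN.
under eq_bigr => j _ do rewrite (horner_coef_wide _ qN) mulr_suml.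
rewrite exchange_big /= (bigD1 (Ordinal kN)) //= [X in _ + X]big1.
  rewrite addr0; under eq_bigr => j _ do
    rewrite -mulrA -exprM -exprD -mulnDr subnKC ?(ltnW kN) //.
  by rewrite -mulr_sumr sum_prim_root // dvdnn mulrC.
move=> i ik; under eq_bigr => j _ do rewrite -mulrA -exprM -exprD -mulnDr.
rewrite -mulr_sumr sum_prim_root //.
case: ifP => [|_]; last by rewrite mulr0.
have iN := ltn_ord i; case/dvdnP => d dE.
have : (i : nat) <> k by move=> E; case/eqP: ik; apply/val_inj.
by case: d dE => [|[|d]]; nia.
Qed.

(** The exact mean value property of polynomials, on regular polygons. *)
Lemma horner_mean N w (p : {poly R[i]}) z d : N.-primitive_root w ->
  (size p <= N)%N -> N%:R * p.[z] = \sum_(j < N) p.[z + d * w ^+ j].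
Proof.
move=> wN pN; pose q := p \Po (z%:P + d *: 'X).
have qE v : q.[v] = p.[z + d * v] by rewrite horner_comp !hornerE.
have qN : (size q <= N)%N.
  apply: leq_trans (size_comp_poly_leq _ _) _.
  have l2 : (size (z%:P + d *: 'X)%R <= 2)%N.
    apply: leq_trans (size_polyD _ _) _; rewrite geq_max.
    rewrite (leq_trans (size_polyC_leq1 _)) //=.
    by apply: leq_trans (size_scale_leq _ _) _; rewrite size_polyX.
  have N0 := prim_order_gt0 wN.
  move: l2 pN; move: (size p) (size _) => a b; nia.
have := coef_prim_root wN qN (prim_order_gt0 wN).
rewrite -horner_coef0 qE mulr0 addr0 subn0 => <-.
apply: eq_bigr => j _; rewrite qE mulnC exprM (prim_expr_order wN) expr1n.
by rewrite mulr1.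
Qed.

Lemma cmod_coef_le (q : {poly R[i]}) k (A : R) :
  (forall z, cmod z = 1 -> cmod q.[z] <= A) -> cmod q`_k <= A.
Proof.
move=> qA; have [w wN] := prim_root_exists (maxn (size q) k.+1).
move: (2 ^ _)%N wN (ltnW (ltn_expl (maxn (size q) k.+1).+1 (isT : 1 < 2)%N)) => N wN.
rewrite -ltnS ltnS gtn_max => NE.
have := @coef_prim_root N w q k wN ltac:(lia) ltac:(lia).
move=> E; have N0 : (0 : R) < N%:R by rewrite ltr0n (prim_order_gt0 wN).
rewrite -(ler_pM2l N0) -[X in X * cmod _](@ger0_norm _ N%:R) ?ler0n //.
rewrite -(cmod_real N%:R) -cmodM rmorph_nat -E; apply: le_trans (cmod_sum _) _.
apply: (@le_trans _ _ (\sum_(j < N) A)); last first.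
  by rewrite sumr_const card_ord mulr_natl.
by apply: ler_sum => j _; rewrite cmodM !(cmod_prim_root _ wN) mulr1 qA // (cmod_prim_root _ wN).
Qed.

End RootsOfUnity.

(** * Maximum principle on the half-disk *)

Section HalfDisk.
Local Open Scope complex_scope.
Variable R : realType.
Implicit Types (z w : R[i]) (x y : R).

(** Maximum principle on the closed upper half-disk, for the supremum M: every
    point of the half-disk is the centre of a circle that stays inside and
    touches the boundary, and the mean of N values, one of which is at most b, is
    at most M - (M - b) / N.  Hence M <= M - (M - b) / N. *)
Lemma half_disk_max (u : R[i] -> R) (A b : R) :
  (exists (N : nat) (w : R[i]), N.-primitive_root w /\
     forall z d, N%:R * u z <= \sum_(j < N) u (z + d * w ^+ j)) ->
  (forall z, cmod z <= 1 -> u z <= A) ->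
  (forall z, cmod z = 1 -> 0 <= complex.Im z -> u z <= b) ->
  (forall x, -1 <= x <= 1 -> u x%:C <= b) ->
  forall z, cmod z <= 1 -> 0 <= complex.Im z -> u z <= b.
Proof.
move=> [N [w [wN mean]]] uA u_arc u_seg.
pose K : set R := [set y | exists z, [/\ cmod z <= 1, 0 <= complex.Im z & y = u z]]%classic.
have supK : has_sup K.
  split; first by exists (u 0), 0; rewrite /cmod /= expr0n addr0 sqrtr0.
  by exists A => _ [z [z1 _ ->]]; exact: uA.
have ubK z : cmod z <= 1 -> 0 <= complex.Im z -> u z <= sup K.
  by move=> z1 z0; apply: sup_upper_bound => //; exists z.
suff supb : sup K <= b by move=> z z1 z0; apply: le_trans (ubK z z1 z0) supb.
rewrite leNgt; apply/negP => b_lt; set M := sup K in ubK b_lt.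
have N0 := prim_order_gt0 wN.
have N0R : (0 : R) < N%:R by rewrite ltr0n.
suff : M <= M - (M - b) / N%:R.
  by rewrite lerBrDr gerDl leNgt divr_gt0 // subr_gt0.
apply: ge_sup; first by case: supK.
(* The circle of centre z and radius |d| touches the boundary at z + d; the
   other N - 1 values are at most M. *)
have touch z d : cmod z + cmod d <= 1 -> cmod d <= complex.Im z ->
    u (z + d) <= b -> u z <= M - (M - b) / N%:R.
  move=> zd dz ub; rewrite -(ler_pM2l N0R) mulrBr [_ * (_ / _)]mulrC mulfVK ?gt_eqF //.
  apply: le_trans (mean z d) _; rewrite (bigD1 (Ordinal N0)) //= expr0 mulr1.
  have : \sum_(i < N | i != Ordinal N0) u (z + d * w ^+ i) <= \sum_(i < N | i != Ordinal N0) M.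
    apply: ler_sum => j _; have dw : cmod (d * w ^+ j) = cmod d.
      by rewrite cmodM (cmod_prim_root _ wN) mulr1.
    apply: ubK; first by apply: le_trans (cmodD _ _) _; rewrite dw.
    have := norm_Im_le (d * w ^+ j); rewrite dw ImD ler_norml => /andP[]; lra.
  move=> H; apply: le_trans (lerD ub H) _.
  have -> : \sum_(i < N | i != Ordinal N0) M = N%:R * M - M.
    rewrite sumr_const cardC1 card_ord -[in RHS](prednK N0) -natr1 mulrDl mul1r addrK.
    by rewrite mulr_natl.
  lra.
move=> _ [z [z1 z0 ->]]; have [zr|zr] := leP (complex.Im z) (1 - cmod z).
  have cd : cmod (- ('i * (complex.Im z)%:C)) = complex.Im z.
    by rewrite cmodN cmodM cmod_i mul1r cmod_real ger0_norm.
  apply: (touch z (- ('i * (complex.Im z)%:C))); rewrite ?cd //; first by lra.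
  have -> : z - 'i * (complex.Im z)%:C = (complex.Re z)%:C.
    by rewrite {1}[z]complexE addrK.
  apply: u_seg; have := norm_Re_le z; rewrite ler_norml => /andP[]; lra.
have r_gt0 : 0 < cmod z.
  have := norm_Im_le z; rewrite ler_norml => /andP[]; lra.
pose t := (1 - cmod z) / cmod z.
have t_ge0 : 0 <= t by rewrite divr_ge0 ?subr_ge0 // ltW.
have td : cmod (t%:C * z) = 1 - cmod z.
  by rewrite cmodM cmod_real ger0_norm // mulfVK ?gt_eqF.
have zE : z + t%:C * z = ((cmod z)^-1)%:C * z.
  rewrite -{1}[z]mul1r -mulrDl -(rmorph1 (real_complex R)) -rmorphD; congr (_%:C * _).
  by rewrite /t; field; rewrite gt_eqF.
apply: (touch z (t%:C * z)); rewrite ?td ?zE; [lra | lra | apply: u_arc].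
  by rewrite cmodM cmod_real ger0_norm ?invr_ge0 ?(ltW r_gt0) // mulVf ?gt_eqF.
by rewrite ImZ mulr_ge0 // invr_ge0 ltW.
Qed.

Lemma cmod_horner_mean N w (p : {poly R[i]}) : N.-primitive_root w -> (size p <= N)%N ->
  forall z d, N%:R * cmod p.[z] <= \sum_(j < N) cmod p.[z + d * w ^+ j].
Proof.
move=> wN pN z d; rewrite -[X in X * _](@ger0_norm _ N%:R) ?ler0n //.
rewrite -(cmod_real N%:R) -cmodM rmorph_nat (horner_mean _ d wN pN).
exact: cmod_sum.
Qed.

Lemma prim_root_big (p : {poly R[i]}) :
  exists N (w : R[i]), N.-primitive_root w /\ (size p <= N)%N.
Proof.
have [w wN] := prim_root_exists R (size p); exists (2 ^ (size p).+1)%N, w; split=> //.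
by rewrite ltnW // (leq_trans (ltn_expl _ (isT : 1 < 2)%N)) // leq_exp2l.
Qed.

Lemma cmod_horner_le (p : {poly R[i]}) z : cmod z <= 1 ->
  cmod p.[z] <= \sum_(k < size p) cmod p`_k.
Proof.
move=> z1; rewrite horner_coef; apply: le_trans (cmod_sum _) _.
by apply: ler_sum => k _; rewrite cmodM cmodX ler_piMr ?cmod_ge0 // exprn_ile1 ?cmod_ge0.
Qed.

Lemma poly_half_disk_max (p : {poly R[i]}) (b : R) :
  (forall z, cmod z = 1 -> 0 <= complex.Im z -> cmod p.[z] <= b) ->
  (forall x, -1 <= x <= 1 -> cmod p.[x%:C] <= b) ->
  forall z, cmod z <= 1 -> 0 <= complex.Im z -> cmod p.[z] <= b.
Proof.
apply: (@half_disk_max (fun z => cmod p.[z])); last exact: cmod_horner_le.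
have [N [w [wN pN]]] := prim_root_big p; exists N, w; split=> // z d.
exact: cmod_horner_mean.
Qed.

Lemma poly_half_disk_Im_max (p : {poly R[i]}) (b : R) :
  (forall z, cmod z = 1 -> 0 <= complex.Im z -> complex.Im p.[z] <= b) ->
  (forall x, -1 <= x <= 1 -> complex.Im p.[x%:C] <= b) ->
  forall z, cmod z <= 1 -> 0 <= complex.Im z -> complex.Im p.[z] <= b.
Proof.
apply: (@half_disk_max (fun z => complex.Im p.[z])); last first.
  move=> z z1; apply: le_trans (ler_norm _) _; apply: le_trans (norm_Im_le _) _.
  exact: cmod_horner_le z1.
have [N [w [wN pN]]] := prim_root_big p; exists N, w; split=> // z d.
by rewrite -Im_sum -(horner_mean _ d wN pN) -(rmorph_nat (real_complex R)) ImZ.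
Qed.

End HalfDisk.

(** * Generating function of an eigenvector *)

Section GeneratingFunction.
Local Open Scope complex_scope.
Variable R : realType.
Implicit Types (z w : R[i]) (x y : R).

(** Both sides are the coefficient of 'X^i in the two forms of
    ((1 + 'X) + z (1 - 'X)) ^ n = ((1 + z) + (1 - z) 'X) ^ n. *)
Lemma sum_bin_krawtchouk n i z : (i <= n)%N ->
  \sum_(k < n.+1) 'C(n, k)%:R * (krawtchouk R n i k)%:C * z ^+ k =
  'C(n, i)%:R * (1 - z) ^+ i * (1 + z) ^+ (n - i).
Proof.
move=> i_le.
have KE k : (krawtchouk R n i k)%:C = ((1 + 'X) ^+ (n - k) * (1 - 'X) ^+ k : {poly R[i]})`_i.
  rewrite /krawtchouk -coef_map rmorphM !rmorphXn /= rmorphD rmorphB rmorph1 /=.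
  by rewrite map_polyX.
transitivity (((1 + 'X) + (1 - 'X) * z%:P) ^+ n : {poly R[i]})`_i.
  rewrite exprDn coef_sum; apply: eq_bigr => k _.
  rewrite exprMn mulrA -polyC_exp coefMn coefMC KE -mulr_natl; ring.
have -> : 1 + 'X + (1 - 'X) * z%:P = (1 + z)%:P + (1 - z)%:P * 'X.
  by rewrite polyCB polyCD polyC1; ring.
rewrite exprDn coef_sum (bigD1 (Ordinal (i_le : (i < n.+1)%N))) //= big1.
  rewrite addr0 coefMn exprMn -!polyC_exp mulrA -polyCM coefCM coefXn eqxx mulr1.
  by rewrite -mulr_natl; ring.
move=> k ki; rewrite coefMn exprMn -!polyC_exp mulrA -polyCM coefCM coefXn.
case: eqP => [E|_]; last by rewrite mulr0 mul0rn.
by case/eqP: ki; apply: val_inj.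
Qed.

Definition mass n (g : 'rV[R]_n.+1) : R := \sum_(i < n.+1) 'C(n, i)%:R * `|g 0 i|.

(** On generating functions the transform acts by z |-> (1 - z) / (1 + z). *)
Lemma eigen_generating_function n (g : 'rV[R]_n.+1) (e : R) z :
  (e = 1 \/ e = -1) -> krawtchouk_transform g = e *: g ->
  \sum_(k < n.+1) ('C(n, k)%:R * g 0 k)%:C * z ^+ k =
  (e * 2 `^ (- (n%:R / 2)))%:C *
    \sum_(i < n.+1) ('C(n, i)%:R * g 0 i)%:C * ((1 - z) ^+ i * (1 + z) ^+ (n - i)).
Proof.
move=> e1 gE.
have gk k : g 0 k = e * 2 `^ (- (n%:R / 2)) * \sum_(i < n.+1) krawtchouk R n i k * g 0 i.
  have := congr1 (fun h : 'rV_n.+1 => h 0 k) gE; rewrite !mxE -mulrA => ->.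
  by case: e1 => ->; rewrite ?mul1r // !mulN1r opprK.
set q := _ * 2 `^ _ in gk *; clearbody q.
transitivity (\sum_(k < n.+1) \sum_(i < n.+1)
    q%:C * (g 0 i)%:C * ('C(n, k)%:R * (krawtchouk R n i k)%:C * z ^+ k)).
  apply: eq_bigr => k _; rewrite gk !rmorphM rmorph_nat rmorph_sum.
  rewrite [RHS](eq_bigr (fun i : 'I_n.+1 => 'C(n, k)%:R * q%:C * z ^+ k *
      (krawtchouk R n i k * g 0 i)%:C)); last by move=> i _; rewrite rmorphM; ring.
  by rewrite -mulr_sumr; ring.
rewrite mulr_sumr.
rewrite exchange_big /=; apply: eq_bigr => i _.
rewrite -mulr_sumr sum_bin_krawtchouk; last by rewrite -ltnS.
by rewrite [in RHS]rmorphM [in RHS]rmorph_nat; ring.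
Qed.

(** The generating function in the variable - i z: the rotation maps the upper
    half-disk, whose diameter is real, to the right one. *)
Definition gen_poly n (g : 'rV[R]_n.+1) : {poly R[i]} :=
  \poly_(k < n.+1) (('C(n, k)%:R * g 0 (inord k))%:C * (- 'i) ^+ k).

Lemma gen_polyE n (g : 'rV[R]_n.+1) z :
  (gen_poly g).[z] = \sum_(k < n.+1) ('C(n, k)%:R * g 0 k)%:C * (- 'i * z) ^+ k.
Proof.
rewrite horner_poly; apply: eq_bigr => k _.
by rewrite inord_val exprMn mulrA.
Qed.

Lemma cmod_gen_poly_le n (g : 'rV[R]_n.+1) z : cmod z <= 1 -> cmod (gen_poly g).[z] <= mass g.
Proof.
move=> z1; rewrite gen_polyE; apply: le_trans (cmod_sum _) _.
apply: ler_sum => k _; rewrite cmodM cmod_real normrM normr_nat cmodX cmodM cmodN cmod_i mul1r.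
by rewrite ler_piMr ?mulr_ge0 // exprn_ile1 ?cmod_ge0.
Qed.

Lemma cmod_coef_gen_poly n (g : 'rV[R]_n.+1) (k : 'I_n.+1) :
  cmod (gen_poly g)`_k = 'C(n, k)%:R * `|g 0 k|.
Proof.
rewrite coef_poly ltn_ord inord_val cmodM cmod_real normrM normr_nat cmodX cmodN cmod_i.
by rewrite expr1n mulr1.
Qed.

(** The eigenvector equation improves the trivial bound where |1 - i x| and
    |1 + i x| coincide. *)
Lemma sqr_cmod_gen_poly_real_le n (g : 'rV[R]_n.+1) (e : R) x :
  (e = 1 \/ e = -1) -> krawtchouk_transform g = e *: g ->
  cmod (gen_poly g).[x%:C] ^+ 2 <= mass g ^+ 2 * ((1 + x ^+ 2) / 2) ^+ n.
Proof.
move=> e1 gE; rewrite gen_polyE (eigen_generating_function _ e1 gE).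
have cm : cmod (1 - - 'i * x%:C) = Num.sqrt (1 + x ^+ 2).
  by congr (Num.sqrt _); rewrite /=; ring.
have cp : cmod (1 + - 'i * x%:C) = Num.sqrt (1 + x ^+ 2).
  by congr (Num.sqrt _); rewrite /=; ring.
have x0 : 0 <= 1 + x ^+ 2 by rewrite addr_ge0 ?sqr_ge0.
rewrite cmodM cmod_real normrM exprMn.
have -> : (`|e| * `|2 `^ (- (n%:R / 2))|) ^+ 2 = (2 ^+ n)^-1 :> R.
  have -> : `|e| = 1 by case: e1 => ->; rewrite ?normrN normr1.
  rewrite mul1r ger0_norm ?powR_ge0 // -powR_mulrn ?powR_ge0 // -powRrM.
  have -> : - (n%:R / 2) * 2%:R = - n%:R :> R by field.
  by rewrite powRN powR_mulrn.
rewrite mulrC expr_div_n [leRHS]mulrA ler_pM2r ?invr_gt0 ?exprn_gt0 //.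
have -> : (1 + x ^+ 2) ^+ n = (Num.sqrt (1 + x ^+ 2) ^+ n) ^+ 2.
  by rewrite exprAC sqr_sqrtr.
rewrite -exprMn ler_pXn2r ?nnegrE ?cmod_ge0 //; last first.
  by rewrite mulr_ge0 ?exprn_ge0 ?sqrtr_ge0 // sumr_ge0 // => i _; rewrite mulr_ge0.
apply: le_trans (cmod_sum _) _; rewrite /mass mulr_suml; apply: ler_sum => i _.
rewrite cmodM cmod_real normrM normr_nat cmodM !cmodX cm cp -exprD subnKC //.
by rewrite -ltnS.
Qed.

End GeneratingFunction.

(** * Polar coordinates *)

Section Polar.
Local Open Scope complex_scope.
Variable R : realType.
Implicit Types (z w : R[i]) (x y r : R).

Lemma de_moivre x m : (cos x +i* sin x) ^+ m = cos (m%:R * x) +i* sin (m%:R * x).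
Proof.
elim: m => [|m IH]; first by rewrite mul0r cos0 sin0.
rewrite exprS IH -natr1 mulrDl mul1r cosD sinD.
by apply/eqP; rewrite eq_complex /=; apply/andP; split; apply/eqP; ring.
Qed.

Lemma arc_polar z : cmod z = 1 -> 0 <= complex.Im z ->
  exists2 x, 0 <= x <= pi & z = cos x +i* sin x.
Proof.
case: z => a b z1 /= b0; have := sqr_cmod (a +i* b); rewrite z1 expr1n /= => E.
have a1 : -1 <= a <= 1.
  by rewrite -ler_norml -(@ler_pXn2r _ 2) ?nnegrE // expr1n real_normK ?num_real // E lerDl sqr_ge0.
exists (acos a); first by rewrite acos_ge0 // acos_lepi.
rewrite acosK // sin_acos // E addrAC subrr add0r sqrtr_sqr ger0_norm //.
Qed.

Lemma Re_scale r z : complex.Re (r%:C * z) = r * complex.Re z.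
Proof. by case: z => a b /=; rewrite mul0r subr0. Qed.

Lemma Im_mul_real_pow r x m : complex.Im ((r%:C * (cos x +i* sin x)) ^+ m) = r ^+ m * sin (m%:R * x).
Proof. by rewrite exprMn -rmorphXn ImZ de_moivre. Qed.

End Polar.

(** * The barrier inside the half-disk *)

Section Majorant.
Local Open Scope complex_scope.
Variable R : realType.
Implicit Types (z w : R[i]) (x y r : R) (N : nat).

Definition defect_poly N : {poly R[i]} := \sum_(j < N) (leibniz_defect R j)%:C *: 'X^(j.*2.+1).

(** A partial sum of the power series whose real part vanishes on [-1, 1] and
    is - ln (1 + Im z) / 2 on the upper half of the unit circle. *)
Definition arc_log_poly N : {poly R[i]} :=
  ('i * (2 / pi)%:C) *: \sum_(j < N) (leibniz_defect R j / j.*2.+1%:R)%:C *: 'X^(j.*2.+1).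

Lemma horner_defect_poly N z : (defect_poly N).[z] = \sum_(j < N) (leibniz_defect R j)%:C * z ^+ j.*2.+1.
Proof. by rewrite horner_sum; apply: eq_bigr => j _; rewrite hornerZ hornerXn. Qed.

Lemma horner_arc_log_poly N z :
  (arc_log_poly N).[z] = 'i * ((2 / pi)%:C * \sum_(j < N) (leibniz_defect R j / j.*2.+1%:R)%:C * z ^+ j.*2.+1).
Proof.
rewrite hornerZ horner_sum -mulrA; congr (_ * (_ * _)).
by apply: eq_bigr => j _; rewrite hornerZ hornerXn.
Qed.

Lemma Re_arc_log_poly N z : complex.Re (arc_log_poly N).[z] =
  - (2 / pi * \sum_(j < N) leibniz_defect R j / j.*2.+1%:R * complex.Im (z ^+ j.*2.+1)).
Proof.
rewrite horner_arc_log_poly mulrC ReiNIm ImZ Im_sum; congr (- (_ * _)).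
by apply: eq_bigr => j _; rewrite ImZ.
Qed.

Lemma sum_leibniz_defect_le1 N : \sum_(j < N) leibniz_defect R j <= 1.
Proof.
have := sum_leibniz_defect_le R (leq0n N); rewrite big_mkord double0 invr1; exact.
Qed.

Lemma cmod_arc_log_poly_le1 N z : cmod z <= 1 -> cmod (arc_log_poly N).[z] <= 1.
Proof.
move=> z1; have pi2 := pi_ge2 R; have pi0 := pi_gt0 R.
have hp : 0 <= 2 / pi :> R by rewrite divr_ge0 // ltW.
rewrite horner_arc_log_poly cmodM cmod_i mul1r cmodM cmod_real ger0_norm //.
apply: mulr_ile1; rewrite ?cmod_ge0 //; first by rewrite ler_pdivrMr // mul1r.
apply: le_trans (cmod_sum _) _; apply: le_trans (sum_leibniz_defect_le1 N).
apply: ler_sum => j _; have j0 := leibniz_defect_ge0 R j.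
rewrite cmodM cmod_real ger0_norm ?divr_ge0 // cmodX -mulrA ler_piMr //.
rewrite mulr_ile1 ?invr_ge0 ?exprn_ge0 ?cmod_ge0 ?exprn_ile1 ?cmod_ge0 //.
by rewrite invf_le1 ?ltr0n // ler1n.
Qed.

(** The imaginary part is harmonic and vanishes on the real axis, so the bound
    on the arc extends to the half-disk. *)
Lemma Im_defect_poly_le N z : cmod z <= 1 -> 0 <= complex.Im z ->
  complex.Im (defect_poly N).[z] <= 2^-1 + N.*2.+1%:R^-1.
Proof.
apply: poly_half_disk_Im_max => [{}z z1 z0|x _].
  have [x xpi ->] := arc_polar z1 z0; apply: le_trans (defect_sin_sum_le N xpi).
  rewrite horner_defect_poly Im_sum le_eqVlt; apply/orP; left; apply/eqP.
  by apply: eq_bigr => j _; rewrite ImZ de_moivre.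
rewrite horner_defect_poly Im_sum big1 ?addr_ge0 ?invr_ge0 // => j _.
by rewrite ImZ -rmorphXn /= mulr0.
Qed.

Lemma norm_Re_arc_log_poly_le N x : (0 < N)%N -> 0 <= x <= pi ->
  `|complex.Re (arc_log_poly N).[cos x +i* sin x] + ln (1 + sin x) / 2| <= N%:R^-1.
Proof.
move=> N0 xpi; have pi0 := pi_gt0 R; have pi2 := pi_ge2 R.
rewrite Re_arc_log_poly.
have -> : \sum_(j < N) leibniz_defect R j / j.*2.+1%:R * complex.Im ((cos x +i* sin x) ^+ j.*2.+1)
   = defect_int_sum N x.
  by apply: eq_bigr => j _; rewrite de_moivre.
have -> : - (2 / pi * defect_int_sum N x) + ln (1 + sin x) / 2 =
   - (2 / pi * (defect_int_sum N x - pi / 4 * ln (1 + sin x))).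
  by move: pi (lt0r_neq0 pi0) => P P0; field.
have hp : 0 <= 2 / pi :> R by rewrite divr_ge0 // ltW.
rewrite normrN normrM ger0_norm //.
have p1 : 2 / pi <= 1 :> R by rewrite ler_pdivrMr // mul1r.
apply: le_trans (_ : 1 * (2 / N.*2.+1%:R) <= _).
  by apply: ler_pM => //; exact: norm_defect_int_sum_sub_le.
rewrite mul1r ler_pdivrMr ?ltr0n // ler_pdivlMl ?ltr0n // -natrM ler_nat; lia.
Qed.

(** A lower bound for the radial derivative of the barrier V between the radii r
    and 1; for r close to 1 and N large it is close to 1/2 - 1/pi. *)
Definition radial_slope r N : R := r / 2 - (1 / pi + N%:R^-1) / r.

(** The left-hand side is the barrier V at the point r e^(i x), up to truncation.
    At r = 1 it is at most 1/N; its derivative in r is the sum of a logarithmic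
    part, at least r/2, and of - (2/pi) Im (defect_poly) / r, at least
    - (1/pi + 1/N) / r. *)
Lemma Re_arc_log_poly_radial_le N x r : (0 < N)%N -> 0 <= x <= pi -> 0 < r < 1 ->
  complex.Re (arc_log_poly N).[r%:C * (cos x +i* sin x)] + ln ((1 + 2 * r * sin x + r ^+ 2) / 2) / 2 <=
  N%:R^-1 - radial_slope r N * (1 - r).
Proof.
move=> N0 xpi /andP[r0 r1]; have pi0 := pi_gt0 R; have pi2 := pi_ge2 R.
have s0 : 0 <= sin x by exact: sin_ge0_pi.
have N0R : 0 < N%:R^-1 :> R by rewrite invr_gt0 ltr0n.
pose q y := \sum_(j < N) leibniz_defect R j / j.*2.+1%:R * sin (j.*2.+1%:R * x) * y ^+ j.*2.+1.
pose dq y := \sum_(j < N) leibniz_defect R j * sin (j.*2.+1%:R * x) * y ^+ j.*2.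
pose h y := (1 + 2 * y * sin x + y ^+ 2) / 2.
pose dh y := sin x + y.
have Re_q y : complex.Re (arc_log_poly N).[y%:C * (cos x +i* sin x)] = - (2 / pi * q y).
  rewrite Re_arc_log_poly; congr (- (_ * _)); apply: eq_bigr => j _.
  by rewrite Im_mul_real_pow mulrA mulrAC.
pose Phi y := - (2 / pi * q y) + ln (h y) / 2 - radial_slope r N * y.
pose dPhi y := - (2 / pi * dq y) + (h y)^-1 * dh y / 2 - radial_slope r N.
have h_gt0 y : 0 < y -> 0 < h y.
  move=> y0; have := sqr_ge0 y; have := mulr_ge0 (ltW y0) s0; rewrite /h; lra.
have Dq y : is_derive y 1 q (dq y).
  apply: (@is_derive_sum_ord _ _ (fun j y => leibniz_defect R j / j.*2.+1%:R * sin (j.*2.+1%:R * x) * y ^+ j.*2.+1)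
    (fun j y => leibniz_defect R j * sin (j.*2.+1%:R * x) * y ^+ j.*2)) => j.
  have := is_derive_monomial (leibniz_defect R j / j.*2.+1%:R * sin (j.*2.+1%:R * x)) j.*2 y.
  have m0 : j.*2.+1%:R != 0 :> R by rewrite pnatr_eq0.
  congr (is_derive _ _ _ _); move: (j.*2.+1%:R : R) m0 => m m0.
  by field.
have Dh y : is_derive y 1 h (dh y).
  have D1 := is_derive_monomial (sin x) 0 y; have D2 := is_derive_monomial (2^-1 : R) 1 y.
  have := is_deriveD (is_deriveD (is_derive_cst (2^-1 : R) y 1) D1) D2.
  congr (is_derive _ _ _ _); last by rewrite /dh; field.
  apply/funext => t; transitivity (2^-1 + sin x * t ^+ 1 + 2^-1 * t ^+ 2) => //.
  by rewrite /h; field.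
have DPhi y : r <= y <= 1 -> is_derive y 1 Phi (dPhi y).
  move=> /andP[ry y1]; have y0 : 0 < y by lra.
  have D1 := is_deriveN (is_deriveZ (2 / pi) (Dq y)).
  have D2 := is_deriveZ 2^-1 (@is_derive1_comp R (@ln R) h y _ _ (is_derive1_ln (h_gt0 y y0)) (Dh y)).
  have D3 := is_derive_monomial (radial_slope r N) 0 y.
  have := is_deriveB (is_deriveD D1 D2) D3.
  congr (is_derive _ _ _ _); last by rewrite /dPhi /GRing.scale /=; ring.
  by apply/funext => t; rewrite /Phi /GRing.scale /= [_ / 2]mulrC.
have dPhi_ge0 y : r <= y <= 1 -> 0 <= dPhi y.
  move=> /andP[ry y1]; have y0 : 0 < y by lra.
  have dq_le : y * dq y <= 2^-1 + N.*2.+1%:R^-1.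
    have -> : y * dq y = complex.Im (defect_poly N).[y%:C * (cos x +i* sin x)].
      rewrite horner_defect_poly Im_sum mulr_sumr; apply: eq_bigr => j _.
      by rewrite ImZ Im_mul_real_pow exprS; ring.
    apply: Im_defect_poly_le; last by rewrite ImZ mulr_ge0 // ltW.
    rewrite cmodM cmod_real gtr0_norm //.
    by rewrite /cmod /= cos2Dsin2 sqrtr1 mulr1; lra.
  have dh_ge : y <= (h y)^-1 * dh y.
    rewrite ler_pdivlMl ?h_gt0 // /h /dh -subr_ge0.
    have -> : sin x + y - (1 + 2 * y * sin x + y ^+ 2) / 2 * y =
      (1 - y) * (1 + y) * (sin x + y / 2) by field.
    by apply: mulr_ge0; [apply: mulr_ge0|]; lra.
  have n1 : 2 / pi * N.*2.+1%:R^-1 <= N%:R^-1 :> R.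
    have p1 : 2 / pi <= 1 :> R by rewrite ler_pdivrMr // mul1r.
    rewrite -[leRHS]mul1r ler_pM ?invr_ge0 ?divr_ge0 ?(ltW pi0) //.
    by rewrite lef_pV2 ?posrE ?ltr0n // ler_nat -addnn -addnS leq_addr.
  have main : 2 / pi * (y * dq y) <= 1 / pi + N%:R^-1.
    apply: le_trans (_ : 2 / pi * (2^-1 + N.*2.+1%:R^-1) <= _).
      by rewrite ler_pM2l // divr_gt0.
    rewrite mulrDr lerD // le_eqVlt; apply/orP; left; apply/eqP.
    by move: pi (lt0r_neq0 pi0) => P P0; field.
  have main2 : 2 / pi * dq y <= (1 / pi + N%:R^-1) / r.
    apply: le_trans (_ : (1 / pi + N%:R^-1) / y <= _).
      by rewrite ler_pdivlMr // [_ * y]mulrC mulrCA.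
    by rewrite ler_pM2l ?lef_pV2 ?posrE // addr_gt0 // divr_gt0.
  rewrite /dPhi /radial_slope; lra.
have : Phi r <= Phi 1 by apply: (derive_ge0_le (ltW r1) DPhi dPhi_ge0).
have e1 := norm_Re_arc_log_poly_le N0 xpi.
have e2 := Re_q 1; rewrite mul1r in e2; rewrite e2 in e1.
move: e1; rewrite ler_norml => /andP[_ e1].
rewrite Re_q /Phi.
have -> : h 1 = 1 + sin x by rewrite /h; field.
rewrite -/(h r); lra.
Qed.

End Majorant.

(** * The polynomial weight *)

Section Certificate.
Local Open Scope complex_scope.
Variable R : realType.
Implicit Types (z w : R[i]) (x y r : R) (N n : nat).

Lemma expR_lower x : x <= 2^-1 -> expR (- (x + 2 * x ^+ 2)) <= 1 - x.
Proof.
move=> x_le; have x1 : 0 < 1 - x by lra.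
rewrite expRN -[leRHS]invrK lef_pV2 ?posrE ?expR_gt0 ?invr_gt0 //.
apply: le_trans (expR_ge1Dx _).
rewrite -[leLHS]mul1r ler_pdivrMr // -subr_ge0.
have -> : (1 + (x + 2 * x ^+ 2)) * (1 - x) - 1 = x ^+ 2 * (1 - 2 * x) by ring.
by rewrite mulr_ge0 ?sqr_ge0 //; lra.
Qed.

(** The Taylor polynomial of 1 / (1 - i z) at z = i, where the radius of
    convergence is 2; the upper half-disk lies within sqrt 2 of i. *)
Definition geom_poly N : {poly R[i]} :=
  (2^-1)%:C *: \sum_(l < N.*2) ((2^-1)%:C *: (1 + 'i *: 'X)) ^+ l.

Lemma horner_geom_poly N z :
  (1 - 'i * z) * (geom_poly N).[z] = 1 - ((2^-1)%:C * (1 + 'i * z)) ^+ N.*2.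
Proof.
rewrite /geom_poly hornerZ horner_sum.
under eq_bigr => l _ do rewrite horner_exp hornerZ hornerD hornerC hornerZ hornerX.
set w := _ * (1 + _); have := subrX1 w N.*2.
set S := \sum_(l < _) _ => E; apply/eqP; rewrite -subr_eq0; apply/eqP.
transitivity ((w ^+ N.*2 - 1) - (w - 1) * S); last by rewrite E subrr.
have h2 : (2^-1)%:C * 2%:R = 1 :> R[i].
  by rewrite -(rmorph_nat (real_complex R) 2) -rmorphM /= mulVf ?pnatr_eq0.
have -> : w - 1 = - ((2^-1)%:C * (1 - 'i * z)) - (1 - (2^-1)%:C * 2%:R).
  by rewrite /w; ring.
by rewrite h2 subrr subr0; ring.
Qed.

Lemma sqr_cmod_1Di z : cmod (1 + 'i * z) ^+ 2 = 1 + cmod z ^+ 2 - 2 * complex.Im z.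
Proof. by rewrite !sqr_cmod; case: z => a b /=; ring. Qed.

Lemma sqr_cmod_1Bi z : cmod (1 - 'i * z) ^+ 2 = 1 + cmod z ^+ 2 + 2 * complex.Im z.
Proof. by rewrite !sqr_cmod; case: z => a b /=; ring. Qed.

Lemma cmod_geom_poly N z : (0 < N)%N -> cmod z <= 1 -> 0 <= complex.Im z ->
  1 - N%:R^-1 <= cmod (1 - 'i * z) * cmod (geom_poly N).[z] <= 1 + N%:R^-1.
Proof.
move=> N0 z1 z0; rewrite -cmodM horner_geom_poly.
set w := _ ^+ N.*2.
have w_le : cmod w <= N%:R^-1.
  have -> : cmod w = ((2^-1 * cmod (1 + 'i * z)) ^+ 2) ^+ N.
    by rewrite /w cmodX cmodM cmod_real ger0_norm ?invr_ge0 // -mul2n exprM.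
  have E : (2^-1 * cmod (1 + 'i * z)) ^+ 2 = 4^-1 * (1 + cmod z ^+ 2 - 2 * complex.Im z).
    by rewrite -sqr_cmod_1Di; field.
  apply: le_trans (_ : (2^-1) ^+ N <= _).
    apply: lerXn2r; rewrite ?nnegrE ?invr_ge0 ?sqr_ge0 // E.
    have : cmod z ^+ 2 <= 1 by rewrite exprn_ile1 ?cmod_ge0.
    by lra.
  by rewrite exprVn -natrX lef_pV2 ?posrE ?ltr0n ?expn_gt0 // ler_nat ltnW // ltn_expl.
apply/andP; split.
  have := cmodD (1 - w) w; rewrite subrK cmod1; lra.
by have := cmodD 1 (- w); rewrite cmodN cmod1; lra.
Qed.

Lemma sqr_cmod_1B w : cmod (1 - w) ^+ 2 = 1 - 2 * complex.Re w + cmod w ^+ 2.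
Proof. by rewrite !sqr_cmod; case: w => a b /=; ring. Qed.

(** (1 - w / N) ^ N replaces exp (- w), up to a factor exp (O(1/N)). *)
Lemma cmod_exp_approx N w : (4 <= N)%N -> cmod w <= 1 ->
  expR (- 2 * complex.Re w - 8 / N%:R) <= (cmod (1 - (N%:R^-1)%:C * w) ^+ 2) ^+ N
   <= expR (- 2 * complex.Re w + 1 / N%:R).
Proof.
move=> N4 w1; have N0 : 0 < N%:R :> R by rewrite ltr0n; lia.
have N4R : 4 <= N%:R :> R by rewrite (ler_nat _ 4).
have c0 := cmod_ge0 w.
pose h : R := N%:R^-1; have h0 : 0 < h by rewrite invr_gt0.
have h4 : h <= 4^-1 by rewrite lef_pV2 ?posrE.
have NhE : N%:R * h = 1 by rewrite mulfV ?gt_eqF.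
rewrite -/h sqr_cmod_1B Re_scale cmodM cmod_real gtr0_norm //.
have : `|complex.Re w| <= 1 by apply: le_trans w1; exact: norm_Re_le.
move: (complex.Re w) (cmod w) c0 w1 => a m m0 m1 a1.
have a2 : a ^+ 2 <= 1 by rewrite -real_normK ?num_real // exprn_ile1.
have m2 : m ^+ 2 <= 1 by rewrite exprn_ile1.
move: a1; rewrite ler_norml => /andP[a1 a1'].
have lo : expR (- (2 * (h * a) + 8 * h ^+ 2)) <= 1 - 2 * (h * a) + (h * m) ^+ 2.
  apply: le_trans (_ : expR (- (2 * (h * a) + 2 * (2 * (h * a)) ^+ 2)) <= _).
    rewrite ler_expR lerN2 lerD2l !exprMn.
    have := ler_wpM2l (sqr_ge0 h) a2; lra.
  apply: le_trans (expR_lower _) _; first by nra.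
  by rewrite lerDl sqr_ge0.
have up : 1 - 2 * (h * a) + (h * m) ^+ 2 <= expR (- (2 * (h * a)) + h ^+ 2).
  apply: le_trans (expR_ge1Dx _); rewrite exprMn.
  by have := ler_wpM2l (sqr_ge0 h) m2; lra.
have E0 : 0 <= 1 - 2 * (h * a) + (h * m) ^+ 2 by apply: le_trans lo; exact: expR_ge0.
have expN x : expR x ^+ N = expR (x * N%:R) by rewrite expRM_natr.
apply/andP; split.
  apply: le_trans (_ : expR (- (2 * (h * a) + 8 * h ^+ 2)) ^+ N <= _); last first.
    by apply: lerXn2r; rewrite ?nnegrE ?expR_ge0.
  rewrite expN ler_expR le_eqVlt; apply/orP; left; apply/eqP.
  rewrite /h; field; lra.
apply: le_trans (_ : expR (- (2 * (h * a)) + h ^+ 2) ^+ N <= _).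
  by apply: lerXn2r; rewrite ?nnegrE ?expR_ge0.
rewrite expN ler_expR le_eqVlt; apply/orP; left; apply/eqP.
rewrite /h; field; lra.
Qed.

(** A polynomial approximation of sqrt 2 / (1 - i z) * exp (- f (z)), where f is
    the limit of arc_log_poly.  The factor exp (- 7 / (2 N)) compensates the
    errors of the approximation, so that the modulus is at most 1 on the arc. *)
Definition weight_poly N : {poly R[i]} :=
  (Num.sqrt (2 * expR (- (7 / N%:R))))%:C *:
    (geom_poly N * (1 - (N%:R^-1)%:C *: arc_log_poly R N) ^+ N).

(** The geometric factor contributes between - 4 / N and 2 / N to the exponent,
    the exponential one between - 8 / N and 1 / N.  With the - 7 / N of the
    normalization, 4 / N is left above, more than the 2 / N lost on the arc by
    truncating f. *)
Lemma sqr_cmod_weight_poly N z : (4 <= N)%N -> cmod z <= 1 -> 0 <= complex.Im z ->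
  2 * expR (- 2 * complex.Re (arc_log_poly R N).[z] - 19 / N%:R) <=
  cmod (weight_poly N).[z] ^+ 2 * (1 + cmod z ^+ 2 + 2 * complex.Im z) <=
  2 * expR (- 2 * complex.Re (arc_log_poly R N).[z] - 4 / N%:R).
Proof.
move=> N4 z1 z0; have N0 : (0 < N)%N by lia.
have N4R : 4 <= N%:R :> R by rewrite (ler_nat _ 4).
have := cmod_exp_approx N4 (cmod_arc_log_poly_le1 N z1).
have := cmod_geom_poly N0 z1 z0.
have -> : (weight_poly N).[z] = (Num.sqrt (2 * expR (- (7 / N%:R))))%:C *
    ((geom_poly N).[z] * (1 - (N%:R^-1)%:C * (arc_log_poly R N).[z]) ^+ N).
  by rewrite hornerZ hornerM horner_exp hornerD hornerC hornerN [((N%:R^-1)%:C *: _).[z]]hornerZ.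
rewrite -sqr_cmod_1Bi !cmodM cmodX cmod_real ger0_norm ?sqrtr_ge0 //.
set E := cmod (geom_poly N).[z]; set D := cmod (1 - 'i * z).
set F := cmod (1 - _); set a := complex.Re _.
move=> DE12; rewrite exprAC => F12.
rewrite [(_ * (E * _)) ^+ 2]exprMn [(E * _) ^+ 2]exprMn sqr_sqrtr ?mulr_ge0 ?expR_ge0 //.
have -> : 2 * expR (- (7 / N%:R)) * (E ^+ 2 * F ^+ N ^+ 2) * D ^+ 2 =
  2 * (expR (- (7 / N%:R)) * ((D * E) ^+ 2 * F ^+ N ^+ 2)) by ring.
have h4 : N%:R^-1 <= 4^-1 :> R by rewrite lef_pV2 ?posrE //; lra.
have h0 : 0 < N%:R^-1 :> R by rewrite invr_gt0; lra.
move: DE12 F12 => /andP[DE1 DE2] /andP[F1 F2].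
rewrite !ler_pM2l //.
have DE0 : 0 <= D * E by lra.
have DE1' : expR (- (4 / N%:R)) <= (D * E) ^+ 2.
  apply: le_trans (_ : (1 - N%:R^-1) ^+ 2 <= _); last first.
    by apply: lerXn2r; rewrite ?nnegrE //; lra.
  have e1 : expR (- (2 / N%:R)) <= 1 - N%:R^-1 :> R.
    apply: le_trans (_ : expR (- (N%:R^-1 + 2 * N%:R^-1 ^+ 2)) <= _); last first.
      by apply: expR_lower; lra.
    rewrite ler_expR lerN2; have := ler_wpM2l (ltW h0) h4; lra.
  have -> : - (4 / N%:R) = - (2 / N%:R) * 2 :> R by ring.
  rewrite expRM_natr; apply: lerXn2r; rewrite ?nnegrE ?expR_ge0 //; lra.
have DE2' : (D * E) ^+ 2 <= expR (2 / N%:R).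
  have -> : 2 / N%:R = N%:R^-1 * 2%:R :> R by ring.
  rewrite expRM_natr; apply: lerXn2r; rewrite ?nnegrE ?expR_ge0 //.
  by apply: le_trans DE2 _; exact: expR_ge1Dx.
apply/andP; split.
  have -> : - 2 * a - 19 / N%:R = - (7 / N%:R) + (- (4 / N%:R) + (- 2 * a - 8 / N%:R)) by ring.
  rewrite !expRD ler_pM2l ?expR_gt0 //; apply: ler_pM; rewrite ?mulr_ge0 ?expR_ge0 //.
  by move: F1; rewrite expRD.
have -> : - 2 * a - 4 / N%:R = - (7 / N%:R) + (2 / N%:R + (- 2 * a + 1 / N%:R)) by ring.
rewrite !(expRD (- (7 / _))) ler_pM2l ?expR_gt0 // expRD.
by apply: ler_pM; rewrite ?sqr_ge0.
Qed.

Lemma weight_poly_arc N z : (4 <= N)%N -> cmod z = 1 -> 0 <= complex.Im z ->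
  cmod (weight_poly N).[z] <= 1.
Proof.
move=> N4 z1 z0; have N0 : (0 < N)%N by lia.
have h0 : 0 < N%:R^-1 :> R by rewrite invr_gt0 ltr0n.
have z1' : cmod z <= 1 by rewrite z1.
have /andP[_] := sqr_cmod_weight_poly N4 z1' z0.
rewrite z1; have [x xpi zE] := arc_polar z1 z0; rewrite zE /=.
have s0 : 0 < 1 + sin x by rewrite ltr_pwDl // sin_ge0_pi.
have := norm_Re_arc_log_poly_le N0 xpi; rewrite ler_norml => /andP[lo _] up.
rewrite -(@ler_pXn2r _ 2) ?nnegrE ?cmod_ge0 // expr1n.
rewrite -(@ler_pM2r _ (2 * (1 + sin x))) ?mulr_gt0 //.
have -> : 2 * (1 + sin x) = 1 + 1 ^+ 2 + 2 * sin x by ring.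
apply: le_trans up _; rewrite mul1r.
have -> : 1 + 1 ^+ 2 + 2 * sin x = 2 * expR (ln (1 + sin x)) by rewrite lnK ?posrE //; ring.
by rewrite ler_pM2l // ler_expR; lra.
Qed.

Lemma weight_poly_seg N x : (4 <= N)%N -> -1 <= x <= 1 ->
  cmod (weight_poly N).[x%:C] ^+ 2 * ((1 + x ^+ 2) / 2) <= 1.
Proof.
move=> N4 x1.
have cx : cmod x%:C <= 1 by rewrite cmod_real ler_norml.
have /andP[_] := sqr_cmod_weight_poly N4 cx (lexx 0 : 0 <= complex.Im x%:C).
have -> : complex.Re (arc_log_poly R N).[x%:C] = 0.
  rewrite Re_arc_log_poly big1 ?mulr0 ?oppr0 // => j _.
  by rewrite -rmorphXn /= mulr0.
rewrite /= mulr0 addr0 mulr0 sub0r cmod_real real_normK ?num_real //.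
have : expR (- (4 / N%:R)) <= 1 :> R by rewrite expR_le1 oppr_le0 divr_ge0.
move: (expR _) => e; lra.
Qed.

Lemma weight_poly_circle_ge N r z : (4 <= N)%N -> 0 < r < 1 -> cmod z = r -> 0 <= complex.Im z ->
  expR (2 * radial_slope r N * (1 - r) - 21 / N%:R) <= cmod (weight_poly N).[z] ^+ 2.
Proof.
move=> N4 r01 zr z0; have N0 : (0 < N)%N by lia.
have /andP[r0 r1] := r01.
have z1 : cmod z <= 1 by rewrite zr ltW.
have /andP[+ _] := sqr_cmod_weight_poly N4 z1 z0.
have [v v1 zE] : exists2 v, cmod v = 1 & z = r%:C * v.
  exists ((r^-1)%:C * z).
    by rewrite cmodM cmod_real ger0_norm ?invr_ge0 ?(ltW r0) // zr mulVf ?gt_eqF.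
  by rewrite mulrA -rmorphM mulfV ?gt_eqF //= mul1r.
have v0 : 0 <= complex.Im v by move: z0; rewrite zE ImZ pmulr_rge0.
have [x xpi vE] := arc_polar v1 v0.
rewrite zr zE ImZ vE /= -/(sin x).
have s0 : 0 <= sin x by exact: sin_ge0_pi.
have q0 : 0 < 1 + r ^+ 2 + 2 * (r * sin x).
  have := sqr_ge0 r; have := mulr_ge0 (ltW r0) s0; lra.
have := Re_arc_log_poly_radial_le N0 xpi r01.
have -> : 1 + 2 * r * sin x + r ^+ 2 = 1 + r ^+ 2 + 2 * (r * sin x) by ring.
set q := 1 + _ + _ in q0 *; set a := complex.Re _ => up lo.
rewrite -(@ler_pM2r _ q) //; apply: le_trans lo.
have -> : q = 2 * expR (ln (q / 2)) by rewrite lnK ?posrE ?divr_gt0 //; field.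
rewrite mulrCA ler_pM2l // -expRD ler_expR; lra.
Qed.

End Certificate.

(** * Concentration of the coefficients *)

Section Concentration.
Local Open Scope complex_scope.
Variable R : realType.
Implicit Types (z w : R[i]) (x y r : R) (N n : nat).

(** Maximum principle for the product of p by the n-th power of the weight, of
    modulus at most S on the boundary. *)
Lemma upper_half_disk_le N n (p : {poly R[i]}) (S : R) z : (4 <= N)%N -> 0 <= S ->
  (forall z, cmod z = 1 -> cmod p.[z] <= S) ->
  (forall x, -1 <= x <= 1 -> cmod p.[x%:C] ^+ 2 <= S ^+ 2 * ((1 + x ^+ 2) / 2) ^+ n) ->
  cmod z <= 1 -> 0 <= complex.Im z ->
  cmod p.[z] * cmod (weight_poly R N).[z] ^+ n <= S.
Proof.
move=> N4 S0 p_arc p_seg z1 z0.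
have FE v : cmod p.[v] * cmod (weight_poly R N).[v] ^+ n = cmod (p * weight_poly R N ^+ n).[v].
  by rewrite hornerM horner_exp cmodM cmodX.
rewrite FE; apply: poly_half_disk_max z1 z0 => [v v1 v0|x x1].
  rewrite -FE -[leRHS]mulr1 ler_pM ?exprn_ge0 ?cmod_ge0 ?p_arc //.
  by rewrite exprn_ile1 ?cmod_ge0 // weight_poly_arc.
rewrite -FE -(@ler_pXn2r _ 2) ?nnegrE ?mulr_ge0 ?exprn_ge0 ?cmod_ge0 //.
rewrite exprMn exprAC; apply: le_trans (_ : S ^+ 2 * ((1 + x ^+ 2) / 2) ^+ n *
    (cmod (weight_poly R N).[x%:C] ^+ 2) ^+ n <= _).
  by rewrite ler_wpM2r ?exprn_ge0 ?cmod_ge0 // p_seg.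
rewrite -mulrA -exprMn ler_piMr ?sqr_ge0 // exprn_ile1 //.
  by rewrite mulr_ge0 ?sqr_ge0 // divr_ge0 // addr_ge0 ?sqr_ge0.
by rewrite mulrC weight_poly_seg.
Qed.

(** The hypotheses on p are invariant under z |-> - z, which gives the lower half
    of the circle. *)
Lemma circle_le N n (p : {poly R[i]}) (S r : R) z : (4 <= N)%N -> 0 <= S -> 0 < r < 1 ->
  (forall z, cmod z = 1 -> cmod p.[z] <= S) ->
  (forall x, -1 <= x <= 1 -> cmod p.[x%:C] ^+ 2 <= S ^+ 2 * ((1 + x ^+ 2) / 2) ^+ n) ->
  cmod z = r ->
  cmod p.[z] <= S * expR (- (radial_slope r N * (1 - r) - 21 / 2 / N%:R) * n%:R).
Proof.
move=> N4 S0 r01 p_arc p_seg.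
wlog : p z p_arc p_seg / 0 <= complex.Im z => [H zr|z0 zr].
  have [z0|z0] := leP 0 (complex.Im z); first exact: H.
  have pN v : p.[v] = (p \Po (- 'X)).[- v].
    by rewrite horner_comp hornerN hornerX opprK.
  rewrite pN; apply: H; rewrite ?cmodN //.
  - by move=> v v1; rewrite -[v]opprK -pN p_arc // cmodN.
  - move=> x x1; have -> : x%:C = - (- x)%:C by rewrite rmorphN opprK.
    by rewrite -pN -[x ^+ 2]sqrrN p_seg //; lra.
  - by move: z0; case: (z) => a b /=; lra.
have z1 : cmod z <= 1 by rewrite zr; lra.
have := upper_half_disk_le N4 S0 p_arc p_seg z1 z0.
have := weight_poly_circle_ge N4 r01 zr z0.
set B := cmod (weight_poly R N).[z]; set t := radial_slope r N * (1 - r) - 21 / 2 / N%:R.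
have -> : 2 * radial_slope r N * (1 - r) - 21 / N%:R = t * 2%:R by rewrite /t; field; rewrite pnatr_eq0; lia.
rewrite expRM_natr => Bt; have {}Bt : expR t <= B.
  by rewrite -(@ler_pXn2r _ 2) ?nnegrE ?expR_ge0 ?cmod_ge0.
move=> H; rewrite mulNr expRN ler_pdivlMr ?expR_gt0 // expRM_natr; apply: le_trans H.
by rewrite ler_wpM2l ?cmod_ge0 // lerXn2r ?nnegrE ?expR_ge0 ?cmod_ge0.
Qed.

Lemma cmod_coef_circle_le (p : {poly R[i]}) k (A r : R) : 0 <= r ->
  (forall z, cmod z = r -> cmod p.[z] <= A) -> cmod p`_k * r ^+ k <= A.
Proof.
move=> r0 pA; pose q := \poly_(j < size p) (p`_j * (r%:C) ^+ j).
have <- : cmod q`_k = cmod p`_k * r ^+ k.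
  rewrite coef_poly; case: ltnP => [_|kp].
    by rewrite cmodM cmodX cmod_real ger0_norm.
  by rewrite nth_default // -[0]/(0%:C) cmod_real normr0 mul0r.
apply: cmod_coef_le => z z1.
have -> : q.[z] = p.[r%:C * z].
  by rewrite horner_poly horner_coef; apply: eq_bigr => j _; rewrite exprMn mulrA.
by apply: pA; rewrite cmodM z1 mulr1 cmod_real ger0_norm.
Qed.

(** For x = 2 (c + 1/pi) < 1 the radius r = (1 + x) / 2 has r ^ 2 > x, which is
    r / 2 - 1 / (pi r) > c / r. *)
Lemma exists_radial_slope_gap (c : R) : 0 <= c -> c < 1 / 2 - 1 / pi ->
  exists r N (gamma : R), [/\ (4 <= N)%N, 0 < r < 1, 0 < gamma &
    2 * gamma <= radial_slope r N * (1 - r) - 21 / 2 / N%:R - c * (r^-1 - 1)].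
Proof.
move=> c0 hc; have pi0 := pi_gt0 R.
have ip : 0 < 1 / pi :> R by rewrite divr_gt0.
pose x := 2 * (c + 1 / pi); pose r := (1 + x) / 2.
have x01 : 0 < x < 1 by rewrite /x; lra.
have r01 : 0 < r < 1 by rewrite /r; lra.
have /andP[r0 r1] := r01.
have rx : x < r ^+ 2.
  rewrite -subr_gt0; have -> : r ^+ 2 - x = ((1 - x) / 2) ^+ 2 by rewrite /r; field.
  by rewrite exprn_gt0 // divr_gt0 //; lra.
pose D := (1 - r) / r * (r ^+ 2 / 2 - 1 / pi - c).
have D0 : 0 < D.
  apply: mulr_gt0; first by rewrite divr_gt0 //; lra.
  by move: rx; rewrite /x; lra.
pose E := (1 - r) / r + 21 / 2.
have E0 : 0 < E by rewrite addr_gt0 // divr_gt0 //; lra.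
pose N := (Num.bound (E / (D / 2)) + 4)%N.
have N0 : 0 < N%:R :> R by rewrite ltr0n /N addn4.
have EN : E / N%:R <= D / 2.
  rewrite ler_pdivrMr // mulrC -ler_pdivrMr ?divr_gt0 //.
  apply: le_trans (ltW (archi_boundP _)) _; first by rewrite ltW // !divr_gt0.
  by rewrite ler_nat leq_addr.
exists r, N, (D / 4); split=> //; first by rewrite leq_addl.
  by rewrite divr_gt0.
have -> : radial_slope r N * (1 - r) - 21 / 2 / N%:R - c * (r^-1 - 1) = D - E / N%:R.
  rewrite /radial_slope /D /E; move: (1 / pi) => P; field.
  by rewrite gt_eqF // gt_eqF.
lra.
Qed.

(** Cauchy's estimate on the circle of radius r; the loss r ^ (- k) is at most
    exp (c n (1/r - 1)). *)
Lemma coef_concentration (c r gamma : R) N n (g : 'rV[R]_n.+1) (e : R) (k : 'I_n.+1) :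
  (4 <= N)%N -> 0 < r < 1 -> 0 <= c ->
  2 * gamma <= radial_slope r N * (1 - r) - 21 / 2 / N%:R - c * (r^-1 - 1) ->
  (e = 1 \/ e = -1) -> krawtchouk_transform g = e *: g -> k%:R <= c * n%:R ->
  'C(n, k)%:R * `|g 0 k| <= mass g * expR (- (2 * gamma) * n%:R).
Proof.
move=> N4 r01 c0 gap e1 gE kc; have /andP[r0 r1] := r01.
have S0 : 0 <= mass g by rewrite sumr_ge0 // => i _; rewrite mulr_ge0.
set t := radial_slope r N * (1 - r) - 21 / 2 / N%:R in gap *.
have H z : cmod z = r -> cmod (gen_poly g).[z] <= mass g * expR (- t * n%:R).
  apply: circle_le => // [v v1|x _]; first by apply: cmod_gen_poly_le; rewrite v1.
  exact: sqr_cmod_gen_poly_real_le e1 gE.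
have := cmod_coef_circle_le k (ltW r0) H; rewrite cmod_coef_gen_poly.
rewrite -ler_pdivlMr ?exprn_gt0 // => /le_trans; apply; rewrite -mulrA ler_wpM2l //.
have rk : (r ^+ k)^-1 <= expR (c * (r^-1 - 1) * n%:R).
  rewrite -exprVn; apply: le_trans (_ : expR (r^-1 - 1) ^+ k <= _).
    apply: lerXn2r; rewrite ?nnegrE ?invr_ge0 ?(ltW r0) ?expR_ge0 //.
    by have := expR_ge1Dx (r^-1 - 1); rewrite addrC subrK.
  rewrite -expRM_natr ler_expR mulrC mulrAC ler_wpM2r //.
  by rewrite subr_ge0 invf_ge1 // ltW.
apply: le_trans (_ : expR (- t * n%:R) * expR (c * (r^-1 - 1) * n%:R) <= _).
  by rewrite ler_pM2l ?expR_gt0.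
rewrite -expRD -mulrDl ler_expR ler_wpM2r //; lra.
Qed.

Lemma succ_le_expR n (gamma : R) : 0 < gamma ->
  n.+1%:R <= (1 + gamma^-1) * expR (gamma * n%:R).
Proof.
move=> g0; have gi : 0 < gamma^-1 by rewrite invr_gt0.
apply: le_trans (_ : (1 + gamma^-1) * (1 + gamma * n%:R) <= _).
  have -> : (1 + gamma^-1) * (1 + gamma * n%:R) = n.+1%:R + (gamma * n%:R + gamma^-1).
    by rewrite -natr1; field; rewrite gt_eqF.
  by rewrite lerDl addr_ge0 ?mulr_ge0 // ltW.
by rewrite ler_wpM2l ?expR_ge1Dx // addr_ge0 // ltW.
Qed.

End Concentration.

Unset Implicit Arguments.

Theorem theorem3p4 (R : realType) (c : R) (hc : c < 1 / 2 - 1 / pi) :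
  exists C gamma : R, 0 < C /\ 0 < gamma /\
    forall (n : nat) (g : 'rV[R]_n.+1),
      (1 <= n)%N ->
      (g <= krawtchouk_eigenspace n (1 : R))%MS \/
      (g <= krawtchouk_eigenspace n (- 1 : R))%MS ->
      \sum_(i < n.+1 | (i%:Z < Num.ceil (c * n%:R))%R) 'C(n, i)%:R * `|g 0 i|
      <= C * expR (- gamma * n%:R) * \sum_(i < n.+1) 'C(n, i)%:R * `|g 0 i|.
Proof.
have [c0|c0] := leP 0 c; last first.
  (* For c < 0 the sum on the left is empty. *)
  exists 1, 1; do 2![split=> //]; move=> n g _ _; rewrite big_pred0.
    by rewrite mulr_ge0 ?mulr_ge0 ?expR_ge0 // sumr_ge0 // => i _; rewrite mulr_ge0.
  move=> i; apply/negbTE; rewrite -leNgt.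
  apply: le_trans (_ : (0 : int) <= _) => //.
  by rewrite ceil_le0 mulr_le0_ge0 // ltW.
have [r [N [gamma [N4 r01 g0 gap]]]] := exists_radial_slope_gap c0 hc.
exists (1 + gamma^-1), gamma; split; first by rewrite addr_gt0 ?invr_gt0.
split=> // n g _ eig.
have [e e1 gE] : exists2 e : R, (e = 1 \/ e = -1) & krawtchouk_transform g = e *: g.
  by case: eig => /krawtchouk_eigenspaceP gE; [exists 1 | exists (-1)]; auto.
have S0 : 0 <= mass g by rewrite sumr_ge0 // => i _; rewrite mulr_ge0.
rewrite -/(mass g).
apply: le_trans (_ : \sum_(i < n.+1) mass g * expR (- (2 * gamma) * n%:R) <= _).
  rewrite big_mkcond /=; apply: ler_sum => i _; case: ifP => [ic|_].
    apply: coef_concentration gap e1 gE _ => //.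
    by move: ic; rewrite ltNge ceil_le_int -ltNge => /ltW.
  by rewrite mulr_ge0 ?expR_ge0.
(* The n + 1 terms cost a factor that half of the exponent absorbs. *)
rewrite sumr_const card_ord -[leLHS]mulr_natl.
have -> : - (2 * gamma) * n%:R = - gamma * n%:R + - gamma * n%:R by ring.
rewrite expRD mulrCA [leRHS]mulrC ler_wpM2l // mulrA ler_pM2r ?expR_gt0 //.
rewrite mulNr expRN ler_pdivrMr ?expR_gt0 //; exact: succ_le_expR.
Qed.
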